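(* Let $k$ be an algebraically closed field of characteristic $p>2$, $G=SL_2$ over $k$, and let $r\in\mathbb{Z}_{>0}$. Then $(T_r(m):\Delta_r(n))\in\{0,1\}$ for all $m,n\in\mathbb{Z}$.
   Context: For $G=SL_2$ with maximal torus $T$, $X(T)=\mathbb{Z}$, the positive root is $2$, $\rho=1$. $F$ is the Frobenius endomorphism, $G_r=\ker F^r$, $G_rT=(F^r)^{-1}(T)$, $B$ and $B^+$ the Borel subgroups containing $T$ with root $-2$ and $2$, $B_r$, $B_r^+$ their $r$-th Frobenius kernels. For $n\in\mathbb{Z}$: $\nabla_r(n)=\mathrm{Ind}_{B_rT}^{G_rT}n$ and $\Delta_r(n)=\mathrm{Ind}_{B_r^+T}^{G_rT}(n-2(p^r-1))$. $T_r(m)$ is the indecomposable tilting (equivalently projective) finite dimensional $G_rT$-module with highest weight $m$; it has a filtration with quotients of the form $\Delta_r(n)$, and $(T_r(m):\Delta_r(n))$ is the number of times $\Delta_r(n)$ occurs. *)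

(* Defs.v *)
From HB Require Import structures.
From mathcomp Require Import all_boot all_order all_algebra.

Set Implicit Arguments.
Unset Strict Implicit.
Unset Printing Implicit Defensive.

Import GRing.Theory.
Local Open Scope ring_scope.

(* Subgroup schemes of SL_2 are given by their functors of points: a family of
   conditions on 2x2 matrices over the commutative k-algebras A. *)
Definition point_functor (k : fieldType) :=
  forall A : comAlgType k, 'M[A]_2 -> Prop.

Section GroupSchemes.
Variables (k : fieldType) (p r : nat).

Definition SL2 : point_functor k := fun A g => \det g = 1.

Definition torus : point_functor k :=
  fun A g => [/\ SL2 g, g 0 1 = 0 & g 1 0 = 0].

(* diag(t, t^-1) multiplies the upper right entry by t^2 under conjugation, so
   the root -2 is that of the lower triangular matrices. *)
Definition borel : point_functor k := fun A g => SL2 g /\ g 0 1 = 0.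

Definition borel_plus : point_functor k := fun A g => SL2 g /\ g 1 0 = 0.

Definition Frob (A : comAlgType k) (g : 'M[A]_2) : 'M[A]_2 :=
  map_mx (fun x : A => x ^+ p) g.

Definition GrT : point_functor k :=
  fun A g => SL2 g /\ torus (iter r (@Frob A) g).

(* T normalises B_r, and B_r T is the preimage of T under the restriction of
   F^r to B; likewise for B^+. *)
Definition BrT : point_functor k := fun A g => borel g /\ GrT g.

Definition BrplusT : point_functor k := fun A g => borel_plus g /\ GrT g.

(* The character diag(t, t^-1) |-> t^n of T, inflated to either Borel subgroup.
   The lower right entry t^-1 is used for negative n, since A need not come
   with an inversion. *)
Definition weight_char (n : int) (A : comAlgType k) (g : 'M[A]_2) : A :=
  match n with
  | Posz i => g 0 0 ^+ i
  | Negz i => g 1 1 ^+ i.+1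
  end.

End GroupSchemes.

Section Modules.
Variables (k : fieldType) (G : point_functor k).

(* A finite dimensional G-module with underlying space the column vectors k^dim:
   a homomorphism of group functors from G to GL_dim.  Only the values of act
   on the points of G are meaningful. *)
Record module := Module {
  dim : nat;
  act : forall A : comAlgType k, 'M[A]_2 -> 'M[A]_dim;
  act_natural : forall (A B : comAlgType k) (phi : {lrmorphism A -> B})
    (g : 'M[A]_2), G g -> act (map_mx phi g) = map_mx phi (act g);
  act1 : forall A : comAlgType k, @act A 1%:M = 1%:M;
  actM : forall (A : comAlgType k) (g h : 'M[A]_2),
    G g -> G h -> act (g *m h) = act g *m act h
}.

Definition base_change (A : comAlgType k) m n (M : 'M[k]_(m, n)) : 'M[A]_(m, n) :=
  map_mx (in_alg A) M.

Definition is_hom (M N : module) (f : 'M[k]_(dim N, dim M)) : Prop :=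
  forall (A : comAlgType k) (g : 'M[A]_2), G g ->
    base_change A f *m act M g = act N g *m base_change A f.

Definition short_exact (M' M M'' : module) : Prop :=
  exists (i : 'M[k]_(dim M, dim M')) (q : 'M[k]_(dim M'', dim M)),
    [/\ is_hom i, is_hom q,
        forall u : 'cV[k]_(dim M'), i *m u = 0 -> u = 0,
        forall v : 'cV[k]_(dim M), q *m v = 0 <-> exists u, v = i *m u
      & forall w : 'cV[k]_(dim M''), exists v, w = q *m v].

(* M is the internal direct sum of (the images of) X and Y. *)
Definition is_direct_sum (X Y M : module) : Prop :=
  exists (i : 'M[k]_(dim M, dim X)) (j : 'M[k]_(dim M, dim Y)),
    [/\ is_hom i, is_hom j
      & forall v : 'cV[k]_(dim M),
          exists! u : 'cV[k]_(dim X) * 'cV[k]_(dim Y),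
            v = i *m u.1 + j *m u.2].

Definition indecomposable (M : module) : Prop :=
  dim M <> 0%N /\
  forall X Y : module, is_direct_sum X Y M -> dim X = 0%N \/ dim Y = 0%N.

(* filtration P M s: there is a chain 0 = M_0 <= M_1 <= ... <= M_l = M of
   submodules with M_i / M_(i-1) satisfying P n_i, where
   s = [:: n_l; ...; n_1]. *)
Inductive filtration (P : int -> module -> Prop) : module -> seq int -> Prop :=
| filtration_nil M : dim M = 0%N -> filtration P M [::]
| filtration_cons M' M Q n s :
    filtration P M' s -> P n Q -> short_exact M' M Q ->
    filtration P M (n :: s).

Definition is_weight (M : module) (n : int) : Prop :=
  exists2 v : 'cV[k]_(dim M), v != 0 &
    forall (A : comAlgType k) (t : 'M[A]_2), torus t ->
      act M t *m base_change A v = weight_char n t *: base_change A v.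

Definition highest_weight (M : module) (m : int) : Prop :=
  is_weight M m /\ forall n : int, is_weight M n -> (n <= m)%R.

(* The elements f of k[G] (natural maps from G to the affine line) such that
   f(x h) = h^-1 f(x) for h in H, where H acts through the character n. *)
Definition ind_section (H : point_functor k) (n : int)
    (f : forall A : comAlgType k, 'M[A]_2 -> A) : Prop :=
  (forall (A B : comAlgType k) (phi : {lrmorphism A -> B}) (x : 'M[A]_2),
     G x -> f B (map_mx phi x) = phi (f A x)) /\
  (forall (A : comAlgType k) (x h : 'M[A]_2),
     G x -> H A h -> f A (x *m h) = weight_char (- n) h * f A x).

(* M is isomorphic to Ind_H^G n: for some basis f of the space of sections,
   M gives the matrices of the action (g . f)(x) = f(g^-1 x) in that basis.
   For g in SL_2 the inverse of g is \adj g. *)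
Definition is_Ind (H : point_functor k) (n : int) (M : module) : Prop :=
  exists f : 'I_(dim M) -> forall A : comAlgType k, 'M[A]_2 -> A,
    [/\ forall j, ind_section H n (f j),
        forall phi, ind_section H n phi ->
          exists! c : 'rV[k]_(dim M), forall (A : comAlgType k) (x : 'M[A]_2),
            G x -> phi A x = \sum_j c 0 j *: f j A x
      & forall (A : comAlgType k) (g x : 'M[A]_2) j, G g -> G x ->
          f j A (\adj g *m x) = \sum_i act M g i j * f i A x].

End Modules.

Section GrTModules.
Variables (k : fieldType) (p r : nat).

Notation GrT_module := (module (GrT (k := k) p r)).

Definition is_nabla (n : int) (M : GrT_module) : Prop :=
  is_Ind (BrT p r) n M.

Definition is_Delta (n : int) (M : GrT_module) : Prop :=
  is_Ind (BrplusT p r) (n - 2 * (p%:Z ^+ r - 1)) M.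

Definition tilting (M : GrT_module) : Prop :=
  (exists s, filtration is_Delta M s) /\ (exists s, filtration is_nabla M s).

Definition is_Tr (m : int) (M : GrT_module) : Prop :=
  [/\ indecomposable M, tilting M & highest_weight M m].

(* c is the number of occurrences of Delta_r(n) in a Delta_r-filtration of M. *)
Definition is_Delta_mult (M : GrT_module) (n : int) (c : nat) : Prop :=
  exists2 s, filtration is_Delta M s & c = count_mem n s.

End GrTModules.

(* Main.v *)
Require Import Defs.
From HB Require Import structures.
From Stdlib Require Import ClassicalEpsilon Classical_Prop.
From mathcomp Require Import all_boot all_order all_algebra ring zify.

(** Write [q = p ^ r].  The multiplicity of Delta_r(n) in T is bounded by the
    multiplicity of a simple module L in a module induced from the character
    of a Borel subgroup, and such a module has q weights, each of multiplicity
    one; hence the bound 1.  The argument below works on the socle of T and does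
    not use the classification of the simple modules.

    The action of the two unipotent groups of G_r T on M is recorded by the
    divided powers E_i = [root_op M true i] and F_i = [root_op M false i]
    ([i < q]), and that of the torus by the weight projections [wt_proj M n].
    They satisfy E_i E_j = binomial(i + j, j) E_(i+j) ([X_mul]), they shift
    weights ([wt_X]), and a relation for opposite root vectors acting on a
    vector killed by one of the families ([X_swap]).  A linear map is
    equivariant if and only if it commutes with all of them ([hom_X], [hom_wt],
    [hom_of_ops]).

    For a linear map u between two modules that commutes with the torus, the
    relative trace F_(q-1) E_(q-1) u, for the conjugation action, is equivariant
    ([trace_hom]).  If L has a Delta_r-filtration, every functional on L killed
    by all F_j, [0 < j], factors through F_(q-1) ([Delta_filtration_top]).  If
    moreover M has a nabla_r-filtration, Frobenius reciprocity for each factor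
    shows that every homomorphism from L to M is a trace
    ([nabla_filtration_trace]).  So the identity of the tilting module T is the
    trace of some u, which is the injectivity criterion of Higman: a
    homomorphism f from a submodule to T extends to the trace of [u *m f'], for
    any torus-equivariant linear extension f' of f.

    If two nonzero submodules of T had zero intersection, extending the
    projection of their sum onto one of them would give an endomorphism that is
    neither nilpotent nor invertible, and the Fitting decomposition would split
    T ([stable_disjoint]).  So an indecomposable T has a smallest nonzero
    submodule, containing a weight vector v ([simple_socle]).

    Finally the number of factors Delta_r(n) is at most the rank of F_(q-1) on
    the weight space of weight n ([Delta_filtration_top]).  A nonzero vector x
    in the image of this operator is killed by all F_j, [0 < j], so it generates
    the submodule spanned by the E_j x; this contains v, and by weights v is a
    multiple of E_j x for a single j that does not depend on x.  Hence E_j maps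
    the image injectively to a line ([topw_rank_le1]). *)

Set Implicit Arguments.
Unset Strict Implicit.
Unset Printing Implicit Defensive.
Import Order.TTheory GRing.Theory Num.Theory.
Local Open Scope ring_scope.
Local Notation dim := Defs.dim.

(** * Adjoining a root of a monic polynomial to an algebra *)

Section Adjoin.
Import Pdiv.Ring Pdiv.RingMonic.
Variables (k : fieldType) (A : comAlgType k).

(** The quotient [A[X] / (h)], for [h] monic of degree at least 2, as an algebra
    over [k] and not only over [A]. *)
Definition adjoin (h : {poly A}) : Type := {poly %/ h}.

Variable h : {poly A}.

HB.instance Definition _ := GRing.ComNzRing.on (adjoin h).

Definition adjoin_scale (c : k) (z : adjoin h) : adjoin h :=
  (c%:A : A) *: (z : {poly %/ h}).

Fact adjoin_scaleA a b z :
  adjoin_scale a (adjoin_scale b z) = adjoin_scale (a * b) z.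
Proof. by rewrite /adjoin_scale scalerA mulr_algl scalerA. Qed.
Fact adjoin_scale1 : left_id 1 adjoin_scale.
Proof. by move=> z; rewrite /adjoin_scale scale1r scale1r. Qed.
Fact adjoin_scaleDr : right_distributive adjoin_scale +%R.
Proof. by move=> a x y; rewrite /adjoin_scale scalerDr. Qed.
Fact adjoin_scaleDl z : {morph adjoin_scale^~ z : a b / a + b}.
Proof. by move=> a b; rewrite /adjoin_scale !scalerDl. Qed.

HB.instance Definition _ := GRing.Zmodule_isLmodule.Build k (adjoin h)
  adjoin_scaleA adjoin_scale1 adjoin_scaleDr adjoin_scaleDl.

Fact adjoin_scaleAl (a : k) (x y : adjoin h) : a *: (x * y) = a *: x * y.
Proof. exact: (@scalerAl A {poly %/ h}). Qed.
HB.instance Definition _ := GRing.Lmodule_isLalgebra.Build k (adjoin h)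
  adjoin_scaleAl.
HB.instance Definition _ := GRing.Lalgebra_isComAlgebra.Build k (adjoin h).

(** The representative of degree less than that of [h], the constants, and the
    class of the indeterminate. *)
Definition adjoin_poly (z : adjoin h) : {poly A} := polyn z.
Definition adjoinC (a : A) : adjoin h := qpolyC h a.
Definition adjoinX : adjoin h := in_qpoly h 'X.

Lemma adjoinC_alg (c : k) : adjoinC c%:A = c%:A.
Proof. by apply: val_inj; rewrite /= -alg_polyC. Qed.

Hypotheses (h_monic : h \is monic) (h_size : (2 < size h)%N).

Lemma mk_monic_adjoin : mk_monic h = h.
Proof. by rewrite /mk_monic h_monic (ltn_trans _ h_size). Qed.

Lemma adjoin_poly_inj : injective adjoin_poly.
Proof. exact: val_inj. Qed.

Lemma adjoin_polyD y z :
  adjoin_poly (y + z) = adjoin_poly y + adjoin_poly z.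
Proof. by []. Qed.

Lemma adjoin_polyZ c z : adjoin_poly (c *: z) = c%:A *: adjoin_poly z.
Proof. by []. Qed.

Lemma adjoin_poly0 : adjoin_poly 0 = 0.
Proof. by []. Qed.

Lemma adjoin_poly_sum I (s : seq I) (P : pred I) (F : I -> adjoin h) :
  adjoin_poly (\sum_(i <- s | P i) F i) = \sum_(i <- s | P i) adjoin_poly (F i).
Proof. exact: (big_morph adjoin_poly adjoin_polyD adjoin_poly0). Qed.

Lemma adjoin_polyM y z :
  adjoin_poly (y * z) = rmodp (adjoin_poly y * adjoin_poly z) h.
Proof. by rewrite -[in RHS]mk_monic_adjoin. Qed.

Lemma adjoin_polyC a : adjoin_poly (adjoinC a) = a%:P.
Proof. by []. Qed.

Lemma in_qpoly_self : in_qpoly h h = 0.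
Proof. by apply: val_inj; rewrite /= mk_monic_adjoin rmodpp. Qed.

Lemma in_qpolyC a : in_qpoly h a%:P = adjoinC a.
Proof.
apply: val_inj; apply: in_qpoly_small.
by rewrite mk_monic_adjoin (leq_ltn_trans (size_polyC_leq1 a)) // ltnW.
Qed.

Lemma size_adjoin_poly z : (size (adjoin_poly z) < size h)%N.
Proof. by rewrite -[in ltnRHS]mk_monic_adjoin; apply: size_mk_monic. Qed.

Lemma adjoin_poly_mulXn a j : (j.+1 < size h)%N ->
  adjoin_poly (adjoinC a * adjoinX ^+ j) = a *: 'X^j.
Proof.
move=> jh; have h1: (1 < size h)%N := ltn_trans (ltnSn 1) h_size.
have jX : adjoin_poly (adjoinX ^+ j) = 'X^j.
  rewrite /adjoinX -(rmorphXn (in_qpoly h)) /adjoin_poly.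
  by rewrite in_qpoly_small // mk_monic_adjoin size_polyXn.
rewrite adjoin_polyM adjoin_polyC jX mul_polyC rmodp_small //.
by rewrite (leq_ltn_trans (size_scale_leq _ _)) // size_polyXn.
Qed.

Lemma adjoin_decomp z :
  z = \sum_(j < (size h).-1) adjoinC ((adjoin_poly z)`_j) * adjoinX ^+ j.
Proof.
apply: adjoin_poly_inj; rewrite adjoin_poly_sum.
have h0 : (0 < size h)%N by apply: leq_trans h_size.
have sz : (size (adjoin_poly z) <= (size h).-1)%N.
  by rewrite -ltnS prednK // size_adjoin_poly.
apply/polyP=> i; rewrite coef_sum.
under eq_bigr => j _ do
  rewrite adjoin_poly_mulXn -1?ltn_predRL // coefZ coefXn mulr_natr mulrb.
case: (ltnP i (size h).-1) => hi; last first.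
  rewrite nth_default ?(leq_trans sz) // big1 // => j _.
  by rewrite gtn_eqF // (leq_trans _ hi).
rewrite (bigD1 (Ordinal hi)) //= eqxx big1 ?addr0 // => j.
by rewrite -val_eqE eq_sym => /negbTE /= ->.
Qed.

Section Lift.
Variables (B : comAlgType k) (psi : {lrmorphism A -> B}) (b : B).
Hypothesis root_b : (map_poly psi h).[b] = 0.

Let ev (z : adjoin h) := (map_poly psi (adjoin_poly z)).[b].

(** The universal property of [adjoin h]. *)
Lemma adjoin_lift : exists phi : {lrmorphism adjoin h -> B},
  (forall a, phi (adjoinC a) = psi a) /\ phi adjoinX = b.
Proof.
have ev_lin : scalable ev.
  move=> c z; rewrite /ev adjoin_polyZ.
  rewrite map_polyZ hornerZ -[RHS]mulr_algl; congr (_ * _).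
  exact: (rmorph_alg psi).
have ev_add : zmod_morphism ev.
  by move=> y z; rewrite /ev (_ : adjoin_poly _ = adjoin_poly y - adjoin_poly z) //
    rmorphB hornerD hornerN.
have ev_mod (u : {poly A}) : (map_poly psi (rmodp u h)).[b] = (map_poly psi u).[b].
  by rewrite [in RHS](rdivp_eq h_monic u) rmorphD rmorphM !hornerE root_b mulr0 add0r.
have ev_mul : monoid_morphism ev.
  split=> [|y z]; first by rewrite /ev /adjoin_poly rmorph1 hornerE.
  by rewrite /ev adjoin_polyM ev_mod rmorphM hornerM.
pose m1 := GRing.isZmodMorphism.Build _ _ ev ev_add.
pose m2 := GRing.isMonoidMorphism.Build _ _ ev ev_mul.
pose m3 := GRing.isScalable.Build _ _ _ _ ev ev_lin.
pose phi : {lrmorphism adjoin h -> B} := HB.pack ev m1 m2 m3.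
exists phi; split=> [a|]; first by rewrite /= /ev adjoin_polyC map_polyC hornerC.
rewrite /= /ev /adjoin_poly /adjoinX in_qpoly_small ?map_polyX ?hornerX //.
by rewrite mk_monic_adjoin size_polyX.
Qed.
End Lift.
End Adjoin.

(** * The coordinate rings of the truncated lines and of the torus *)

Lemma alg_lrmorphism (k : fieldType) (B : comAlgType k) :
  exists psi : {lrmorphism k^o -> B}, forall a, psi a = a%:A.
Proof.
pose f : k^o -> B := in_alg B.
have f_lin : scalable f by move=> c a; rewrite /f /= scalerA.
have f_add : zmod_morphism f by apply: (rmorphB (in_alg B)).
have f_mul : monoid_morphism f.
  by split; [apply: (rmorph1 (in_alg B)) | apply: (rmorphM (in_alg B))].
pose m1 := GRing.isScalable.Build _ _ _ _ f f_lin.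
pose m2 := GRing.isZmodMorphism.Build _ _ f f_add.
pose m3 := GRing.isMonoidMorphism.Build _ _ f f_mul.
pose psi : {lrmorphism k^o -> B} := HB.pack f m1 m2 m3.
by exists psi.
Qed.

Section Truncated.
Variables (k : fieldType) (q : nat).
Hypothesis q_gt1 : (1 < q)%N.

(** The algebra [k[x] / (x ^ q)], its generator and the coefficient of [x ^ i]. *)
Definition truncx : comAlgType k := adjoin ('X^q : {poly k^o}).
Definition tx : truncx := adjoinX _.
Definition tcoef1 (i : nat) (z : truncx) : k := (adjoin_poly z)`_i.

Let size_Xq (R : nzRingType) : (2 < size ('X^q : {poly R}))%N.
Proof. by rewrite size_polyXn. Qed.

Lemma tcoef1D i y z : tcoef1 i (y + z) = tcoef1 i y + tcoef1 i z.
Proof. exact: coefD. Qed.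

Lemma tcoef1Z i c z : tcoef1 i (c *: z) = c * tcoef1 i z.
Proof. by rewrite /tcoef1 adjoin_polyZ coefZ mulr_algl. Qed.

Lemma tcoef1_0 i : tcoef1 i 0 = 0.
Proof. exact: coef0. Qed.

Lemma tcoef1Xn i j : (j < q)%N -> tcoef1 i (tx ^+ j) = (i == j)%:R.
Proof.
move=> jq; rewrite -[_ ^+ _]mul1r (_ : 1 = adjoinC _ 1); last exact/val_inj.
rewrite /tcoef1 /tx adjoin_poly_mulXn ?monicXn ?size_polyXn //.
by rewrite coefZ coefXn mul1r.
Qed.

Lemma tcoef1_ge i z : (q <= i)%N -> tcoef1 i z = 0.
Proof.
move=> hi; rewrite /tcoef1 nth_default // (leq_trans _ hi) // -ltnS.
by have := size_adjoin_poly (monicXn _ q) (size_Xq _) z; rewrite size_polyXn.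
Qed.

Lemma truncx_decomp z : z = \sum_(i < q) tcoef1 i z *: tx ^+ i.
Proof.
rewrite {1}(adjoin_decomp (monicXn _ _) (size_Xq _) z) size_polyXn.
apply: eq_bigr => i _.
rewrite -[_ *: _]mulr_algl -adjoinC_alg.
by congr (adjoinC _ _ * _); rewrite -[LHS]mulr1.
Qed.

Lemma tx_nilp : tx ^+ q = 0.
Proof.
rewrite /tx /adjoinX -(rmorphXn (in_qpoly _)).
exact: (in_qpoly_self (monicXn _ _) (size_Xq _)).
Qed.

Lemma truncx_lift (B : comAlgType k) (b : B) : b ^+ q = 0 ->
  exists phi : {lrmorphism truncx -> B}, phi tx = b.
Proof.
move=> bq; have [psi _] := alg_lrmorphism B.
have r0 : (map_poly psi ('X^q)).[b] = 0.
  by rewrite map_polyXn hornerXn.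
by have [phi [_ e]] := adjoin_lift (monicXn _ _) (size_Xq _) r0; exists phi.
Qed.

(** The algebra [k[x, y] / (x ^ q, y ^ q)], its generators and the coefficient of
    [x ^ i * y ^ j]. *)
Definition truncxy : comAlgType k := adjoin ('X^q : {poly truncx}).
Definition ty1 : truncxy := adjoinC _ tx.
Definition ty2 : truncxy := adjoinX _.
Definition tcoef2 (i j : nat) (z : truncxy) : k := tcoef1 i ((adjoin_poly z)`_j).

Lemma tcoef2D i j y z : tcoef2 i j (y + z) = tcoef2 i j y + tcoef2 i j z.
Proof. by rewrite /tcoef2 adjoin_polyD coefD tcoef1D. Qed.

Lemma tcoef2Z i j c z : tcoef2 i j (c *: z) = c * tcoef2 i j z.
Proof. by rewrite /tcoef2 adjoin_polyZ coefZ mulr_algl tcoef1Z. Qed.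

Lemma tcoef2_0 i j : tcoef2 i j 0 = 0.
Proof. by rewrite /tcoef2 adjoin_poly0 coef0 tcoef1_0. Qed.

Lemma tcoef2_monom i j i' j' : (i' < q)%N -> (j' < q)%N ->
  tcoef2 i j (ty1 ^+ i' * ty2 ^+ j') = ((i == i') && (j == j'))%:R.
Proof.
move=> i'q j'q.
have -> : ty1 ^+ i' = adjoinC _ (tx ^+ i').
  by rewrite /ty1 /adjoinC rmorphXn.
rewrite /tcoef2 /ty2 adjoin_poly_mulXn ?monicXn ?size_polyXn //.
rewrite coefZ coefXn; case: (j == j'); last by rewrite andbF mulr0 tcoef1_0.
by rewrite mulr1 andbT tcoef1Xn.
Qed.

Lemma ty1_nilp : ty1 ^+ q = 0.
Proof. by rewrite /ty1 /adjoinC -rmorphXn tx_nilp rmorph0. Qed.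

Lemma ty2_nilp : ty2 ^+ q = 0.
Proof.
rewrite /ty2 /adjoinX -(rmorphXn (in_qpoly _)).
exact: (in_qpoly_self (monicXn _ _) (size_Xq _)).
Qed.
End Truncated.

Section Laurent.
Variable k : fieldType.

(** The Laurent polynomials in [s], realised as an extension of degree two of
    the polynomials in [c = s + s ^-1]: [s] is a root of [Y ^ 2 - c * Y + 1]. *)
Definition laurent_poly : {poly {poly k}} := 'X^2 - 'X%:P * 'X + 1.

Lemma size_laurent_tail :
  (size (- ('X%:P * 'X) + 1 : {poly {poly k}})%R < size ('X^2 : {poly {poly k}}))%N.
Proof.
rewrite size_polyXn ltnS (leq_trans (size_polyD _ _)) // geq_max size_polyN.
by rewrite size_poly1 mul_polyC (leq_trans (size_scale_leq _ _)) ?size_polyX.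
Qed.

Lemma laurent_poly_monic : laurent_poly \is monic.
Proof.
by rewrite monicE /laurent_poly -addrA lead_coefDl ?size_laurent_tail ?lead_coefXn.
Qed.

Lemma size_laurent_poly : size laurent_poly = 3.
Proof. by rewrite /laurent_poly -addrA size_polyDl ?size_laurent_tail ?size_polyXn. Qed.

Definition laurent : comAlgType k := adjoin laurent_poly.
Definition ls : laurent := adjoinX _.
Definition lsV : laurent := adjoinC _ 'X - ls.

Let size_lp : (2 < size laurent_poly)%N. Proof. by rewrite size_laurent_poly. Qed.

Lemma lsVr : ls * lsV = 1.
Proof.
have e : in_qpoly laurent_poly ('X^2 - 'X%:P * 'X + 1) =
  in_qpoly laurent_poly 'X ^+ 2
  - in_qpoly laurent_poly 'X%:P * in_qpoly laurent_poly 'X + 1.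
  by rewrite !rmorphD rmorph1 rmorphN rmorphXn rmorphM.
have := in_qpoly_self laurent_poly_monic size_lp.
rewrite [X in in_qpoly _ X = _]/laurent_poly e.
rewrite (in_qpolyC laurent_poly_monic size_lp) -/(adjoinX _) -/ls => h.
apply/eqP; rewrite -subr_eq0 -oppr_eq0; apply/eqP; rewrite -[RHS]h /lsV.
ring.
Qed.

(** Every Laurent polynomial is a polynomial in [s] divided by a power of [s]. *)
Lemma laurent_decomp (z : laurent) : exists D f,
  z = horner_alg ls f * lsV ^+ D.
Proof.
pose P (z : laurent) := exists D f, z = horner_alg ls f * lsV ^+ D.
have PD y1 y2 : P y1 -> P y2 -> P (y1 + y2).
  move=> [D1 [f1 ->]] [D2 [f2 ->]].
  exists (D1 + D2)%N, (f1 * 'X^D2 + f2 * 'X^D1).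
  rewrite rmorphD !rmorphM !rmorphXn /= !horner_algX mulrDl.
  have lsn n : ls ^+ n * lsV ^+ n = 1 by rewrite -exprMn lsVr expr1n.
  rewrite exprD; congr (_ + _).
    by rewrite mulrACA -mulrA [ls ^+ _ * _]mulrC mulrA -[RHS]mulrA [_ * ls ^+ _]mulrC lsn mulr1.
  by rewrite [lsV ^+ D1 * _]mulrC mulrACA -mulrA [ls ^+ _ * _]mulrC mulrA
    -[RHS]mulrA [_ * ls ^+ _]mulrC lsn mulr1.
have PM y1 y2 : P y1 -> P y2 -> P (y1 * y2).
  move=> [D1 [f1 ->]] [D2 [f2 ->]]; exists (D1 + D2)%N, (f1 * f2).
  by rewrite rmorphM exprD mulrACA.
have P1 : P 1 by exists 0, 1; rewrite rmorph1 mulr1.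
have P0 : P 0 by exists 0, 0; rewrite rmorph0 mul0r.
have PX y n : P y -> P (y ^+ n).
  by move=> Py; elim: n => // n IH; rewrite exprS; apply: PM.
have Psum I (s : seq I) (F : I -> laurent) : (forall i, P (F i)) -> P (\sum_(i <- s) F i).
  by move=> PF; elim: s => [|i s IH]; rewrite ?big_nil ?big_cons //; apply: PD.
have Pls : P ls by exists 0, 'X; rewrite horner_algX mulr1.
have PlsV : P lsV by exists 1, 1; rewrite rmorph1 mul1r.
have Palg c : P c%:A by exists 0, c%:P; rewrite horner_algC mulr1.
rewrite -/(P z) (adjoin_decomp laurent_poly_monic size_lp z).
apply: (Psum) => j; apply: (PM); last exact: PX.
set g := _`_j; move: g => g.
have -> : g = \sum_(i < size g) (g`_i)%:A * 'X^i.
  rewrite -[LHS]coefK poly_def; apply: eq_bigr => i _.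
  by rewrite mulr_algl.
rewrite /adjoinC rmorph_sum; apply: (Psum) => i.
rewrite rmorphM rmorphXn; apply: (PM).
  by have := Palg g`_i; rewrite -(adjoinC_alg laurent_poly).
apply: PX; change (P (adjoinC laurent_poly 'X)).
have -> : adjoinC laurent_poly 'X = ls + lsV by rewrite /lsV addrC subrK.
exact: PD.
Qed.

(** A point of the torus is a morphism from the Laurent polynomials. *)
Lemma laurent_lift (B : comAlgType k) (a b : B) : a * b = 1 ->
  exists phi : {lrmorphism laurent -> B}, phi ls = a /\ phi lsV = b.
Proof.
move=> ab1.
have f_lin : scalable (horner_alg (a + b) : {poly k} -> B).
  by move=> c u; rewrite -mul_polyC rmorphM /= horner_algC mulr_algl.
pose f : {poly k} -> B := horner_alg (a + b).
have f_add : zmod_morphism f by apply: (rmorphB (horner_alg (a + b))).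
have f_mul : monoid_morphism f.
  by split; [apply: (rmorph1 (horner_alg _)) | apply: (rmorphM (horner_alg _))].
pose m1 := GRing.isScalable.Build _ _ _ _ f f_lin.
pose m2 := GRing.isZmodMorphism.Build _ _ f f_add.
pose m3 := GRing.isMonoidMorphism.Build _ _ f f_mul.
pose psi : {lrmorphism {poly k} -> B} := HB.pack f m1 m2 m3.
have r0 : (map_poly psi laurent_poly).[a] = 0.
  rewrite /laurent_poly !rmorphD rmorph1 rmorphN rmorphXn rmorphM /=.
  rewrite map_polyX map_polyC /=.
  rewrite /f horner_algX !hornerE -ab1.
  ring.
have [phi [e1 e2]] := adjoin_lift laurent_poly_monic size_lp r0.
exists phi; split=> //; rewrite /lsV rmorphB /= e1 e2 /= /f horner_algX.
by rewrite addrC addKr.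
Qed.
End Laurent.

(* These algebras are used only through the lemmas above. *)
Global Opaque truncx truncxy laurent tx ty1 ty2 ls lsV tcoef1 tcoef2.

(** * Unipotent and diagonal 2 x 2 matrices *)

(** Proves [X = Y] when [X - Y] is a multiple of [u - v], for [u = v]. *)
Lemma eq_mod (R : comNzRingType) (u v c X Y : R) :
  u = v -> X - Y = c * (u - v) -> X = Y.
Proof. by move=> ->; rewrite subrr mulr0 => /eqP; rewrite subr_eq0 => /eqP. Qed.

Lemma eq_mod2 (R : comNzRingType) (u v c u' v' c' X Y : R) :
  u = v -> u' = v' -> X - Y = c * (u - v) + c' * (u' - v') -> X = Y.
Proof. by move=> h -> e; apply: (eq_mod h); rewrite e subrr mulr0 addr0. Qed.

Section Matrix22.
Variable R : comNzRingType.

(** The matrix with rows [(a, b)] and [(c, d)]. *)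
Definition mx2 a b c d : 'M[R]_2 :=
  \matrix_(i, j) if i == 0 then if j == 0 then a else b
                 else if j == 0 then c else d.

Lemma mx2_00 a b c d : mx2 a b c d 0 0 = a. Proof. by rewrite mxE. Qed.
Lemma mx2_01 a b c d : mx2 a b c d 0 1 = b. Proof. by rewrite mxE. Qed.
Lemma mx2_10 a b c d : mx2 a b c d 1 0 = c. Proof. by rewrite mxE. Qed.
Lemma mx2_11 a b c d : mx2 a b c d 1 1 = d. Proof. by rewrite mxE. Qed.
Definition mx2E := (mx2_00, mx2_01, mx2_10, mx2_11).

Lemma ord2_ind (P : 'I_2 -> Prop) : P 0 -> P 1 -> forall i, P i.
Proof.
move=> P0 P1 [[|[|i]] hi] //; first by rewrite (_ : Ordinal _ = 0) //; apply: val_inj.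
by rewrite (_ : Ordinal _ = 1) //; apply: val_inj.
Qed.

Lemma mx2_ext (g h : 'M[R]_2) : g 0 0 = h 0 0 -> g 0 1 = h 0 1 ->
  g 1 0 = h 1 0 -> g 1 1 = h 1 1 -> g = h.
Proof.
by move=> *; apply/matrixP; apply: ord2_ind; apply: ord2_ind.
Qed.

Lemma mx2_eta (g : 'M[R]_2) : g = mx2 (g 0 0) (g 0 1) (g 1 0) (g 1 1).
Proof. by apply: mx2_ext; rewrite mx2E. Qed.

Lemma mulmx2E (g h : 'M[R]_2) i j : (g *m h) i j = g i 0 * h 0 j + g i 1 * h 1 j.
Proof.
rewrite mxE big_ord_recl big_ord1; congr (_ + g i _ * h _ j);
by apply: val_inj.
Qed.

Lemma mulmx2 a b c d a' b' c' d' : mx2 a b c d *m mx2 a' b' c' d' =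
  mx2 (a * a' + b * c') (a * b' + b * d') (c * a' + d * c') (c * b' + d * d').
Proof. by apply: mx2_ext; rewrite mulmx2E !mx2E. Qed.

Lemma det2 (g : 'M[R]_2) : \det g = g 0 0 * g 1 1 - g 0 1 * g 1 0.
Proof.
rewrite (expand_det_row _ 0) big_ord_recl big_ord1 /cofactor !det_mx11 !mxE /=.
rewrite mul1r expr1 mulN1r mulrN.
by congr (g _ _ * g _ _ - g _ _ * g _ _); apply: val_inj.
Qed.

Lemma adj2 (g : 'M[R]_2) : \adj g = mx2 (g 1 1) (- g 0 1) (- g 1 0) (g 0 0).
Proof.
apply: mx2_ext; rewrite mx2E mxE /cofactor det_mx11 !mxE /=
  ?expr0 ?expr1 ?expr2 ?mulN1r ?mulrN1 ?opprK ?mul1r.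
all: try by congr (g _ _); apply: val_inj.
all: try by congr (- g _ _); apply: val_inj.
Qed.

Lemma mx2_1 : 1%:M = mx2 1 0 0 1.
Proof. by apply: mx2_ext; rewrite !mxE. Qed.

(** The upper ([b = true]) and lower ([b = false]) unipotent matrices. *)
Definition uni (b : bool) (a : R) := if b then mx2 1 a 0 1 else mx2 1 0 a 1.
(** The diagonal matrices; [a'] stands for the inverse of [a]. *)
Definition tor (a a' : R) := mx2 a 0 0 a'.

Lemma uniD b x y : uni b x *m uni b y = uni b (x + y).
Proof.
by case: b; rewrite /uni mulmx2; congr mx2; ring.
Qed.

Lemma uni0 b : uni b 0 = 1%:M.
Proof. by case: b; rewrite mx2_1. Qed.

Lemma torM a a' b b' : tor a a' *m tor b b' = tor (a * b) (a' * b').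
Proof. by rewrite /tor mulmx2; congr mx2; ring. Qed.

Lemma tor1 : tor 1 1 = 1%:M.
Proof. by rewrite mx2_1. Qed.

Lemma adj_uni b x : \adj (uni b x) = uni b (- x).
Proof. by case: b; rewrite adj2 !mx2E oppr0. Qed.

Lemma adj_tor a a' : \adj (tor a a') = tor a' a.
Proof. by rewrite adj2 !mx2E oppr0. Qed.

(** The diagonal matrix with entries [a] and [a'], in the order for which
    conjugation multiplies the parameter of [uni b] by [a ^+ 2]. *)
Definition torb (b : bool) (a a' : R) := if b then tor a a' else tor a' a.

Lemma tor_uni b a a' x : a * a' = 1 ->
  torb b a a' *m uni b x = uni b (a ^+ 2 * x) *m torb b a a'.
Proof.
move=> h; case: b; rewrite /tor !mulmx2; congr mx2; try ring;
by apply: (eq_mod (c := - (a * x)) h); ring.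
Qed.

(** Opposite unipotent matrices can be exchanged where [1 + x * y] is a unit. *)
Lemma uni_swap b x y w w' : w = 1 + x * y -> w * w' = 1 ->
  uni b x *m uni (~~ b) y =
  uni (~~ b) (y * w') *m (torb b w w' *m uni b (x * w')).
Proof.
move=> wE h.
have h2 : (1 + x * y) * w' = 1 by rewrite -wE.
case: b; rewrite /= /torb /tor !mulmx2 wE; congr mx2; try ring.
- by apply: (eq_mod (c := - x) h2); ring.
- by apply: (eq_mod (c := - y) h2); ring.
- by apply: (eq_mod (c := - (1 + x * y * w')) h2); ring.
- by apply: (eq_mod (c := - (1 + x * y * w')) h2); ring.
- by apply: (eq_mod (c := - y) h2); ring.
by apply: (eq_mod (c := - x) h2); ring.
Qed.

(** The entry of [g] in the position of the parameter of [uni b]. *)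
Definition off (b : bool) (g : 'M[R]_2) := if b then g 0 1 else g 1 0.

(** The big cell: a matrix of determinant one with [1 + g 0 1 * g 1 0]
    invertible is the product of two opposite unipotent matrices and a diagonal
    one. *)
Lemma uni_factor b (g : 'M[R]_2) s : \det g = 1 -> (1 + g 0 1 * g 1 0) * s = 1 ->
  exists u t t', t * t' = 1 /\
    g = uni b (off b g * u) *m (tor t t' *m uni (~~ b) (off (~~ b) g * u)).
Proof.
rewrite det2 (mx2_eta g) !mx2E.
move: (g 0 0) (g 0 1) (g 1 0) (g 1 1) => {g} a b' c d hd hs.
have hd' : a * d = 1 + b' * c by rewrite -hd subrK.
have h3 : a * d * s = 1 by rewrite hd'.
have hbc : b' * c = a * d - 1 by rewrite hd' addrC addKr.
case: b.
  exists (a * s), (a * s), d; split; first by rewrite mulrAC hd'.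
  rewrite /= !mulmx2 !mx2E; congr mx2; try ring.
  - apply: (eq_mod2 (c := - (a ^+ 2 * d * s ^+ 2)) 
      (c' := a * s - a * (1 + a * d * s)) hbc h3); ring.
  - by apply: (eq_mod (c := - b') h3); ring.
  by apply: (eq_mod (c := - c) h3); ring.
exists (d * s), a, (d * s); split; first by rewrite mulrA hd'.
rewrite /= !mulmx2 !mx2E; congr mx2; try ring.
- by apply: (eq_mod (c := - b') h3); ring.
- by apply: (eq_mod (c := - c) h3); ring.
by apply: (eq_mod2 (c := - (d ^+ 2 * a * s ^+ 2)) (c' := d * s - d * (1 + a * d * s)) hbc h3); ring.
Qed.
End Matrix22.

(** * Points of G_r T *)

Section Points.
Variables (k : fieldType) (p r : nat).
Hypothesis hp : p \in [pchar k].
Local Notation q := (p ^ r)%N.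
Implicit Types A B : comAlgType k.

Lemma q_pnat A : [pchar A].-nat q.
Proof.
rewrite pnatX; apply/orP; left.
by rewrite pnatE ?(pchar_lalg A) // (pcharf_prime hp).
Qed.

Lemma exprDq A (x y : A) : (x + y) ^+ q = x ^+ q + y ^+ q.
Proof. by apply: exprDn_pchar; apply: q_pnat. Qed.

Lemma q_gt0 : (0 < q)%N.
Proof. by rewrite expn_gt0 prime_gt0 // (pcharf_prime hp). Qed.

Lemma iter_Frob A (g : 'M[A]_2) : iter r (@Frob k p A) g = map_mx (fun x => x ^+ q) g.
Proof.
elim: r => [|n IH] /=; first by apply/matrixP=> i j; rewrite !mxE.
by rewrite IH /Frob; apply/matrixP=> i j; rewrite !mxE expnSr exprM.
Qed.

Lemma GrTP A (g : 'M[A]_2) : GrT p r g <->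
  [/\ \det g = 1, g 0 1 ^+ q = 0 & g 1 0 ^+ q = 0].
Proof.
rewrite /GrT /torus /SL2 iter_Frob !mxE; split=> [[-> [_ -> ->]]|[h1 h2 h3]] //.
split=> //; split=> //; rewrite det2 !mxE h2 mul0r subr0 -exprMn.
move: h1; rewrite det2 => /eqP; rewrite subr_eq => /eqP ->.
by rewrite exprDq exprMn h2 mul0r expr1n addr0.
Qed.

Lemma GrT_uni A b (x : A) : x ^+ q = 0 -> GrT p r (uni b x).
Proof.
move=> hx; apply/GrTP; rewrite det2.
by case: b; rewrite !mx2E !(mul0r, mulr0, mulr1, subr0) ?expr0n -?(lt0n) gtn_eqF ?q_gt0.
Qed.

Lemma torusP A (g : 'M[A]_2) : torus g <-> exists t t', t * t' = 1 /\ g = tor t t'.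
Proof.
rewrite /torus /SL2 det2; split=> [[h1 h2 h3]|[t [t' [h ->]]]]; last first.
  by rewrite !mx2E h mul0r subr0.
exists (g 0 0), (g 1 1); rewrite -[RHS]h1 h2 mul0r subr0; split=> //.
by rewrite [LHS]mx2_eta h2 h3.
Qed.

Lemma GrT_torus A (g : 'M[A]_2) : torus g -> GrT p r g.
Proof.
move=> [h1 h2 h3]; apply/GrTP; rewrite h2 h3 expr0n gtn_eqF ?q_gt0 //.
Qed.

Lemma torus_tor A (t t' : A) : t * t' = 1 -> torus (tor t t').
Proof. by move=> h; apply/torusP; exists t, t'. Qed.

Lemma torus_torb A b (t t' : A) : t * t' = 1 -> torus (torb b t t').
Proof. by case: b => h; apply: torus_tor; rewrite // mulrC. Qed.

Lemma GrTM A (g h : 'M[A]_2) : GrT p r g -> GrT p r h -> GrT p r (g *m h).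
Proof.
move=> /GrTP[g1 g2 g3] /GrTP[h1 h2 h3]; apply/GrTP.
rewrite det_mulmx g1 h1 mulr1 !mulmx2E; split=> //.
  by rewrite exprDq !exprMn h2 g2 mulr0 mul0r addr0.
by rewrite exprDq !exprMn h3 g3 mulr0 mul0r addr0.
Qed.

Lemma GrT_adj A (g : 'M[A]_2) : GrT p r g -> GrT p r (\adj g).
Proof.
move=> /GrTP[g1 g2 g3]; apply/GrTP; move: (g1); rewrite !det2 adj2 !mx2E => e.
rewrite mulrNN [g 1 1 * _]mulrC; split=> //.
  by rewrite exprNn g2 mulr0.
by rewrite exprNn g3 mulr0.
Qed.

Lemma GrT1 A : GrT p r (1%:M : 'M[A]_2).
Proof. by rewrite -(uni0 A true); apply: GrT_uni; rewrite expr0n gtn_eqF ?q_gt0. Qed.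

Lemma GrT_mulVg A (g : 'M[A]_2) : GrT p r g -> \adj g *m g = 1%:M.
Proof. by move=> [h _]; rewrite mul_adj_mx h. Qed.

(** Inverse of a unipotent scalar. *)
Lemma unipotent_inv A (n : A) m : n ^+ m = 0 -> exists s, (1 + n) * s = 1.
Proof.
move=> hn; exists (\sum_(i < m) (- n) ^+ i).
have := subrX1 (- n) m; rewrite exprNn hn mulr0 sub0r => e.
by rewrite -[RHS]opprK e -mulNr opprD opprK addrC opprK.
Qed.

(** All points of G_r T lie in the big cell, as their off-diagonal entries are
    nilpotent. *)
Lemma GrT_factor A b (g : 'M[A]_2) : GrT p r g -> exists u t t',
  [/\ t * t' = 1, (off b g * u) ^+ q = 0, (off (~~ b) g * u) ^+ q = 0 &
    g = uni b (off b g * u) *m (tor t t' *m uni (~~ b) (off (~~ b) g * u))].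
Proof.
move=> /GrTP[g1 g2 g3].
have hn : (g 0 1 * g 1 0) ^+ q = 0 by rewrite exprMn g2 mul0r.
have [s hs] := unipotent_inv hn.
have [u [t [t' [e1 e2]]]] := uni_factor b g1 hs.
have ho c : off c g ^+ q = 0 by case: c.
by exists u, t, t'; split; rewrite // exprMn ho mul0r.
Qed.

Lemma map_uni A B (phi : {lrmorphism A -> B}) b x :
  map_mx phi (uni b x) = uni b (phi x).
Proof. by case: b; apply: mx2_ext; rewrite mxE !mx2E ?rmorph0 ?rmorph1. Qed.

Lemma map_tor A B (phi : {lrmorphism A -> B}) x y :
  map_mx phi (tor x y) = tor (phi x) (phi y).
Proof. by apply: mx2_ext; rewrite mxE !mx2E ?rmorph0. Qed.

(** The character [n] of the torus as a function of the diagonal entries; this is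
    [weight_char] with its arguments separated. *)
Definition chi A (n : int) (a a' : A) : A :=
  match n with Posz i => a ^+ i | Negz i => a' ^+ i.+1 end.

Lemma weight_charE A n (g : 'M[A]_2) : weight_char n g = chi n (g 0 0) (g 1 1).
Proof. by []. Qed.

Lemma weight_char_tor A n (t t' : A) : weight_char n (tor t t') = chi n t t'.
Proof. by rewrite weight_charE !mx2E. Qed.

Lemma chiN A n (a a' : A) : chi (- n) a a' = chi n a' a.
Proof. by case: n => [[|n]|n]. Qed.

Lemma chi_subn A (a a' : A) (i j : nat) : a * a' = 1 -> 
  chi (i%:Z - j%:Z) a a' = a ^+ i * a' ^+ j.
Proof.
move=> h; have e n : a ^+ n * a' ^+ n = 1 by rewrite -exprMn h expr1n.
case: (leqP j i) => hij.
  rewrite subzn // /chi -{2}(subnK hij) exprD -mulrA e mulr1 //.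
rewrite -opprB subzn ?(ltnW hij) // chiN /chi -{2}(subnK (ltnW hij)) exprD.
by rewrite mulrCA e mulr1.
Qed.

Lemma chiD A m n (a a' : A) : a * a' = 1 -> chi (m + n) a a' = chi m a a' * chi n a a'.
Proof.
move=> h.
have [i1 [j1 ->]] : exists i j : nat, m = i%:Z - j%:Z.
  by case: m => i; [exists i, 0%N; rewrite subr0 | exists 0%N, i.+1; rewrite sub0r NegzE].
have [i2 [j2 ->]] : exists i j : nat, n = i%:Z - j%:Z.
  by case: n => i; [exists i, 0%N; rewrite subr0 | exists 0%N, i.+1; rewrite sub0r NegzE].
rewrite addrACA -opprD -!PoszD !chi_subn // !exprD; ring.
Qed.

Lemma chiM A n (a a' b b' : A) : chi n (a * b) (a' * b') = chi n a a' * chi n b b'.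
Proof. by case: n => i /=; rewrite exprMn. Qed.

Lemma map_chi A B (phi : {lrmorphism A -> B}) n a a' :
  phi (chi n a a') = chi n (phi a) (phi a').
Proof. by case: n => i; rewrite rmorphXn. Qed.

Lemma chi_exprz (n : int) (c : k) : @chi k^o n c c^-1 = c ^ n.
Proof. by case: n => i //=; rewrite exprVn. Qed.
End Points.

(** * Base change, and the divided powers of the root vectors *)

Section BaseChange.
Variables (k : fieldType).
Implicit Types A B : comAlgType k.

Lemma base_changeM A m n l (M : 'M[k]_(m, n)) (N : 'M[k]_(n, l)) :
  base_change A (M *m N) = base_change A M *m base_change A N.
Proof. exact: map_mxM. Qed.
Lemma base_changeD A m n (M N : 'M[k]_(m, n)) :
  base_change A (M + N) = base_change A M + base_change A N.
Proof. exact: map_mxD. Qed.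
Lemma base_change0 A m n : base_change A (0 : 'M[k]_(m, n)) = 0.
Proof. exact: map_mx0. Qed.
Lemma base_change1 A n : base_change A (1%:M : 'M[k]_n) = 1%:M.
Proof. by rewrite /base_change map_mx1. Qed.
Lemma base_changeZ A m n c (M : 'M[k]_(m, n)) :
  base_change A (c *: M) = c%:A *: base_change A M.
Proof. exact: map_mxZ. Qed.
Lemma base_change_sum A m n I (s : seq I) (P : pred I) (F : I -> 'M[k]_(m, n)) :
  base_change A (\sum_(i <- s | P i) F i) = \sum_(i <- s | P i) base_change A (F i).
Proof. exact: (big_morph _ (@base_changeD A m n) (base_change0 A m n)). Qed.

Lemma base_change_id m n (M : 'M[k]_(m, n)) : base_change k^o M = M.
Proof. by apply/matrixP=> i j; rewrite mxE; exact: mulr1. Qed.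

Lemma map_base_change A B (phi : {lrmorphism A -> B}) m n (M : 'M[k]_(m, n)) :
  map_mx phi (base_change A M) = base_change B M.
Proof. by apply/matrixP=> i j; rewrite !mxE; exact: (rmorph_alg phi). Qed.

Lemma map_mx_lrZ A B (phi : {lrmorphism A -> B}) m n a (M : 'M[A]_(m, n)) :
  map_mx phi (a *: M) = phi a *: map_mx phi M.
Proof. exact: map_mxZ. Qed.

Lemma lrmorphZ A B (phi : {lrmorphism A -> B}) (c : k) x : phi (c *: x) = c *: phi x.
Proof. exact: linearZ. Qed.

Lemma map_expansion A B (phi : {lrmorphism A -> B}) m n I (s : seq I)
    (a : I -> A) (M : I -> 'M[k]_(m, n)) :
  map_mx phi (\sum_(i <- s) a i *: base_change A (M i)) =
  \sum_(i <- s) phi (a i) *: base_change B (M i).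
Proof.
elim: s => [|i s IH]; first by rewrite !big_nil map_mx0.
by rewrite !big_cons map_mxD IH map_mx_lrZ map_base_change.
Qed.

Lemma in_alg_inj A : injective (in_alg A).
Proof. exact: fmorph_inj. Qed.

Lemma base_change_inj A m n : injective (@base_change k A m n).
Proof.
move=> M N /matrixP e; apply/matrixP=> i j; apply: (@in_alg_inj A).
by have := e i j; rewrite !mxE.
Qed.

(** The [k]-linear functionals on [A]; applied entrywise, they turn an identity
    between matrices over [A] into one between matrices over [k]. *)
Definition functional A (f : A -> k) :=
  (forall x y, f (x + y) = f x + f y) /\ (forall c x, f (c *: x) = c * f x).

Lemma functional0 A (f : A -> k) : functional f -> f 0 = 0.
Proof. by move=> [_ h]; rewrite -(scale0r (0 : A)) h mul0r. Qed.

Lemma functional_sum A (f : A -> k) I (s : seq I) (P : pred I) (F : I -> A) :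
  functional f -> f (\sum_(i <- s | P i) F i) = \sum_(i <- s | P i) f (F i).
Proof. by move=> h; apply: big_morph; [apply: h.1 | apply: functional0]. Qed.

Lemma map_functional_sum A (f : A -> k) m n I (s : seq I) (P : pred I)
   (F : I -> 'M[A]_(m, n)) : functional f ->
  map_mx f (\sum_(i <- s | P i) F i) = \sum_(i <- s | P i) map_mx f (F i).
Proof.
move=> hf; apply/matrixP=> i j; rewrite !mxE !summxE functional_sum //.
by apply: eq_bigr => l _; rewrite !mxE.
Qed.

Lemma map_functional_scale A (f : A -> k) m n a (M : 'M[k]_(m, n)) :
  functional f -> map_mx f (a *: base_change A M) = f a *: M.
Proof.
by move=> hf; apply/matrixP=> i j; rewrite !mxE mulrC mulr_algl hf.2 mulrC.
Qed.

Lemma map_functional A (f : A -> k) m n I (s : seq I) (P : pred I)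
   (a : I -> A) (M : I -> 'M[k]_(m, n)) : functional f ->
  map_mx f (\sum_(i <- s | P i) a i *: base_change A (M i)) =
  \sum_(i <- s | P i) f (a i) *: M i.
Proof.
move=> hf; rewrite map_functional_sum //.
by apply: eq_bigr => l _; rewrite map_functional_scale.
Qed.

(** Comparing coefficients in an identity between two expansions. *)
Lemma functional_expansion A (f : A -> k) m n I J (s : seq I) (t : seq J)
   (a : I -> A) (M : I -> 'M[k]_(m, n)) (b : J -> A) (N : J -> 'M[k]_(m, n)) :
  functional f ->
  \sum_(i <- s) a i *: base_change A (M i) = \sum_(j <- t) b j *: base_change A (N j) ->
  \sum_(i <- s) f (a i) *: M i = \sum_(j <- t) f (b j) *: N j.
Proof. by move=> hf /(congr1 (map_mx f)); rewrite !map_functional. Qed.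

Lemma functional_expansion1 A (f : A -> k) m n I (s : seq I)
   (a : I -> A) (M : I -> 'M[k]_(m, n)) (b : A) (N : 'M[k]_(m, n)) :
  functional f -> \sum_(i <- s) a i *: base_change A (M i) = b *: base_change A N ->
  \sum_(i <- s) f (a i) *: M i = f b *: N.
Proof.
by move=> hf /(congr1 (map_mx f)); rewrite map_functional // map_functional_scale.
Qed.

Lemma map_functional2 A (f : A -> k) m n I J (s : seq I) (t : seq J)
   (a : I -> J -> A) (M : I -> J -> 'M[k]_(m, n)) : functional f ->
  map_mx f (\sum_(i <- s) \sum_(j <- t) a i j *: base_change A (M i j)) =
  \sum_(i <- s) \sum_(j <- t) f (a i j) *: M i j.
Proof.
move=> hf; rewrite map_functional_sum //.
by apply: eq_bigr => i _; rewrite map_functional.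
Qed.

Lemma functional_expansion2 A (f : A -> k) m n I J L (s : seq I) (t : seq J) (u : seq L)
   (a : I -> J -> A) (M : I -> J -> 'M[k]_(m, n)) (b : L -> A) (N : L -> 'M[k]_(m, n)) :
  functional f ->
  \sum_(i <- s) \sum_(j <- t) a i j *: base_change A (M i j) =
    \sum_(l <- u) b l *: base_change A (N l) ->
  \sum_(i <- s) \sum_(j <- t) f (a i j) *: M i j = \sum_(l <- u) f (b l) *: N l.
Proof. by move=> hf /(congr1 (map_mx f)); rewrite map_functional2 ?map_functional. Qed.

Lemma scale_expansion A m n I (s : seq I) (c : A) (a : I -> A) (M : I -> 'M[k]_(m, n)) :
  c *: (\sum_(i <- s) a i *: base_change A (M i)) =
  \sum_(i <- s) (c * a i) *: base_change A (M i).
Proof. by rewrite scaler_sumr; apply: eq_bigr => i _; rewrite scalerA. Qed.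

Lemma mul_expansion A m n l I J (s : seq I) (t : seq J) (a : I -> A) (b : J -> A)
  (M : I -> 'M[k]_(m, n)) (N : J -> 'M[k]_(n, l)) :
  (\sum_(i <- s) a i *: base_change A (M i)) *m
  (\sum_(j <- t) b j *: base_change A (N j)) =
  \sum_(i <- s) \sum_(j <- t) (a i * b j) *: base_change A (M i *m N j).
Proof.
rewrite mulmx_suml; apply: eq_bigr => i _; rewrite mulmx_sumr.
apply: eq_bigr => j _; rewrite base_changeM.
by rewrite -scalemxAl -scalemxAr scalerA.
Qed.

Lemma base_change_mul_suml A m n l I (s : seq I) (a : I -> A)
  (M : I -> 'M[k]_(m, n)) (N : 'M[k]_(n, l)) :
  (\sum_(i <- s) a i *: base_change A (M i)) *m base_change A N =
  \sum_(i <- s) a i *: base_change A (M i *m N).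
Proof.
by rewrite mulmx_suml; apply: eq_bigr => i _; rewrite -scalemxAl base_changeM.
Qed.

Lemma base_change_mul_sumr A m n l I (s : seq I) (a : I -> A)
  (M : I -> 'M[k]_(m, n)) (N : 'M[k]_(l, m)) :
  base_change A N *m (\sum_(i <- s) a i *: base_change A (M i)) =
  \sum_(i <- s) a i *: base_change A (N *m M i).
Proof.
by rewrite mulmx_sumr; apply: eq_bigr => i _; rewrite -scalemxAr base_changeM.
Qed.
End BaseChange.

Lemma functional_coef1 (k : fieldType) q i : functional (@tcoef1 k q i).
Proof. by split; [apply: tcoef1D | apply: tcoef1Z]. Qed.

Lemma functional_coef2 (k : fieldType) q i j : functional (@tcoef2 k q i j).
Proof. by split; [apply: tcoef2D | apply: tcoef2Z]. Qed.

Lemma sum_tcoef1_Xn (k : fieldType) q (V : lmodType k) (i : nat) (M : nat -> V) :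
  (1 < q)%N -> (i < q)%N ->
  \sum_(j < q) tcoef1 i (tx k q ^+ j) *: M j = M i.
Proof.
move=> hq hi; rewrite (bigD1 (Ordinal hi)) //= tcoef1Xn // eqxx scale1r.
rewrite big1 ?addr0 // => j hj; rewrite tcoef1Xn //.
by rewrite eq_sym (negbTE (hj : (j != i :> nat))) scale0r.
Qed.

Lemma sum_tcoef1 (k : fieldType) q (V : lmodType k) (i : nat) (c : nat -> k) (M : nat -> V) :
  (1 < q)%N -> (i < q)%N ->
  \sum_(j < q) tcoef1 i (c j *: tx k q ^+ j) *: M j = c i *: M i.
Proof.
move=> hq hi; rewrite (bigD1 (Ordinal hi)) //= tcoef1Z tcoef1Xn // eqxx mulr1.
rewrite big1 ?addr0 // => j hj; rewrite tcoef1Z tcoef1Xn //.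
by rewrite eq_sym (negbTE (hj : (j != i :> nat))) mulr0 scale0r.
Qed.

Section Operators.
Variables (k : closedFieldType) (p r : nat).
Hypotheses (hp : p \in [pchar k]) (r_gt0 : (0 < r)%N).
Local Notation q := (p ^ r)%N.
Local Notation GM := (module (GrT (k := k) p r)).
Implicit Types (A B : comAlgType k) (M N : GM).

Lemma q_gt1 : (1 < q)%N.
Proof. by rewrite -(exp1n r) ltn_exp2r // prime_gt1 // (pcharf_prime hp). Qed.
Local Hint Resolve q_gt1 : core.

(** The divided powers of the root vectors: the coefficients of the action of
    the generic point of the unipotent groups. *)
Definition root_op M (b : bool) (i : nat) : 'M[k]_(dim M) :=
  map_mx (tcoef1 i) (act M (uni b (tx k q))).
Local Notation X := root_op.

Lemma X_ge M b i : (q <= i)%N -> X M b i = 0.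
Proof.
by move=> hi; apply/matrixP=> a c; rewrite !mxE tcoef1_ge // q_gt1.
Qed.

(** The unipotent groups act through the divided powers, since [truncx] is
    their coordinate ring. *)
Lemma act_uni M b A (a : A) : a ^+ q = 0 ->
  act M (uni b a) = \sum_(i < q) a ^+ i *: base_change A (X M b i).
Proof.
move=> ha; have [phi hphi] := truncx_lift q_gt1 ha.
rewrite -hphi -map_uni act_natural; last first.
  by apply: (GrT_uni hp); apply: tx_nilp.
apply/matrixP=> c d; rewrite mxE summxE {1}(truncx_decomp q_gt1 (act _ _ _ _)).
rewrite rmorph_sum; apply: eq_bigr => i _.
by rewrite !mxE [LHS](lrmorphZ phi) rmorphXn mulrC mulr_algl.
Qed.

Lemma X0 M b : X M b 0 = 1%:M.
Proof.
have h0 : (0 : k^o) ^+ q = 0 by rewrite expr0n gtn_eqF // (q_gt0 r hp).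
have := act_uni M b h0; rewrite uni0 act1 => /esym.
have hq : q = q.-1.+1 by rewrite prednK ?(q_gt0 r hp).
rewrite (eq_bigr (fun i : 'I_q => (0 : k^o) ^+ i *: X M b i)); last first.
  by move=> i _; rewrite base_change_id.
move: (X M b) => Y; rewrite {}hq big_ord_recl expr0 scale1r big1 ?addr0 //.
by move=> i _; rewrite expr0n scale0r.
Qed.

Lemma tcoef2_monom' i j l m e : (i < q)%N -> (j < q)%N ->
  tcoef2 i j (ty1 k q ^+ l * ty2 k q ^+ m *+ e) = (((i == l) && (j == m)) * e)%:R.
Proof.
move=> hi hj; rewrite -scaler_nat tcoef2Z mulrC natrM.
case: (ltnP l q) => hl; last first.
  rewrite -(subnK hl) exprD (ty1_nilp k q_gt1) mulr0 mul0r tcoef2_0.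
  by rewrite (ltn_eqF (leq_trans hi _)) // subnK.
case: (ltnP m q) => hm; last first.
  rewrite -(subnK hm) exprD (ty2_nilp k q_gt1) !mulr0 tcoef2_0.
  by rewrite andbC (ltn_eqF (leq_trans hj _)) // subnK.
by rewrite tcoef2_monom.
Qed.

(** The multiplication of divided powers, from [uniD] over [truncxy]. *)
Lemma X_mul M b i j : X M b i *m X M b j = 'C(i + j, j)%:R *: X M b (i + j).
Proof.
case: (ltnP i q) => hi; last first.
  by rewrite (X_ge _ _ hi) mul0mx (X_ge _ _ (leq_trans hi (leq_addr j i))) scaler0.
case: (ltnP j q) => hj; last first.
  by rewrite (X_ge _ _ hj) mulmx0 (X_ge _ _ (leq_trans hj (leq_addl i j))) scaler0.
have h1 := ty1_nilp k q_gt1; have h2 := ty2_nilp k q_gt1.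
have h12 : (ty1 k q + ty2 k q) ^+ q = 0 by rewrite (exprDq r hp) h1 h2 addr0.
have := act_uni M b h12; rewrite -uniD actM; try exact: (GrT_uni hp).
rewrite !act_uni // mul_expansion => /(congr1 (map_mx (tcoef2 i j))).
have hf := @functional_coef2 k q i j.
rewrite map_functional2 // map_functional //.
rewrite (bigD1 (Ordinal hi)) //= (bigD1 (Ordinal hj)) //=.
have e l m : tcoef2 i j (ty1 k q ^+ l * ty2 k q ^+ m) = ((i == l) && (j == m))%:R.
  by rewrite -[_ * _]mulr1n tcoef2_monom' // muln1.
rewrite e !eqxx scale1r big1 ?addr0; last first.
  by move=> m hm; rewrite e eqxx eq_sym (negbTE (hm : (m != j :> nat))) scale0r.
rewrite big1 ?addr0; last first.
  move=> l hl; rewrite big1 // => m _.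
  by rewrite e eq_sym (negbTE (hl : (l != i :> nat))) scale0r.
move=> ->.
have e2 l : tcoef2 i j ((ty1 k q + ty2 k q) ^+ l) = ((l == i + j)%N * 'C(i + j, j))%:R.
  rewrite exprDn functional_sum //.
  case: (eqVneq l (i + j)%N) => [->|hl].
    have hj' : (j < (i + j).+1)%N by rewrite ltnS leq_addl.
    rewrite (bigD1 (Ordinal hj')) //= tcoef2_monom' // addnK !eqxx big1 ?addr0 //.
    by move=> m hm; rewrite tcoef2_monom' // andbC eq_sym (negbTE (hm : (m != j :> nat))).
  rewrite big1 // => m _; rewrite tcoef2_monom' //.
  case: eqP => //= e1; case: eqP => //= e2; case/eqP: hl.
  by rewrite e1 e2 subnK // -ltnS.
case: (ltnP (i + j) q) => hij; last first.
  rewrite X_ge // scaler0 big1 // => l _; rewrite e2.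
  by rewrite ltn_eqF ?scale0r // (leq_trans _ hij).
rewrite (bigD1 (Ordinal hij)) //= e2 eqxx mul1n big1 ?addr0 // => l hl.
by rewrite e2 (negbTE (hl : (l != i + j :> nat)%N)) scale0r.
Qed.
End Operators.

(** * Weight spaces *)

Section LaurentCoef.
Variable k : closedFieldType.

(** A polynomial [f] vanishing outside zero is zero: otherwise [f * 'X - 1] has a
    root [c], and then [f.[c] != 0] and [c != 0]. *)
Lemma closed_poly_eq0 (f : {poly k}) : (forall c, c != 0 -> f.[c] = 0) -> f = 0.
Proof.
move=> hf; apply/eqP; apply: contraT => f0.
have sz : size (f * 'X - 1) != 1.
  have sfX : (1 < size (f * 'X)%R)%N by rewrite size_mulX // ltnS lt0n size_poly_eq0.
  by rewrite size_polyDl ?size_polyN ?size_poly1 // neq_ltn sfX orbT.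
have [c] := closed_rootP _ sz.
rewrite rootE !hornerE subr_eq0 => /eqP hc.
have c0 : c != 0 by apply: contra_eq_neq hc => ->; rewrite mulr0 eq_sym oner_eq0.
by rewrite hf // mul0r in hc; move/eqP: hc; rewrite eq_sym oner_eq0.
Qed.

Lemma big_supp (V : nmodType) (s s' : seq int) (F : int -> V) :
  uniq s -> uniq s' -> {subset s <= s'} ->
  (forall n, n \notin s -> F n = 0) ->
  \sum_(n <- s) F n = \sum_(n <- s') F n.
Proof.
move=> us us' ss h; rewrite [RHS](bigID (mem s)) /= [X in _ + X]big1 ?addr0 //.
rewrite -[RHS]big_filter; apply: perm_big; apply: uniq_perm => //.
  exact: filter_uniq.
by move=> n; rewrite mem_filter; case: (boolP (n \in s)) => //= /ss ->.
Qed.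

(** The powers with integer exponents are linearly independent functions on the
    nonzero scalars. *)
Lemma exprz_coef_scalar (s : seq int) (f : int -> k) : uniq s ->
  (forall c, c != 0 -> \sum_(n <- s) c ^ n * f n = 0) ->
  forall n, n \in s -> f n = 0.
Proof.
move=> us h n0 hn0.
pose D := (\sum_(n <- s) `|n|)%N.
have hD n : n \in s -> exists i : nat, n + D%:Z = i%:Z.
  move=> hn; have hb : (`|n| <= D)%N.
    by rewrite /D (big_rem n) //= leq_addr.
  exists (absz (n + D%:Z)); rewrite gez0_abs // -[n]opprK addrC subr_ge0.
  by rewrite (le_trans (ler_norm _)) // normrN -abszE lez_nat.
pose e n := absz (n + D%:Z).
have he n : n \in s -> n + D%:Z = (e n)%:Z.
  by move=> /hD[i hi]; rewrite /e hi.
pose P := \sum_(n <- s) f n *: 'X^(e n).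
have P0 : P = 0.
  apply: closed_poly_eq0 => c c0.
  suff -> : P.[c] = c ^+ D * \sum_(n <- s) c ^ n * f n by rewrite h // mulr0.
  rewrite /P horner_sum mulr_sumr; apply: eq_big_seq => n hn.
  rewrite hornerZ hornerXn mulrA mulrC; congr (_ * _).
  by rewrite !exprnP -(he n hn) addrC expfzDr.
have := congr1 (fun u : {poly k} => u`_(e n0)) P0.
rewrite coef0 coef_sum (bigD1_seq n0) //= coefZ coefXn eqxx mulr1.
rewrite big_seq_cond big1 ?addr0 // => n /andP[hn hnn].
rewrite coefZ coefXn; case: eqP => [E|]; last by rewrite mulr0.
have := he n hn; rewrite -E -he // => /addIr E2.
by rewrite E2 eqxx in hnn.
Qed.

Lemma exprz_coef (s : seq int) m n (F : int -> 'M[k]_(m, n)) : uniq s ->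
  (forall c, c != 0 -> \sum_(n <- s) c ^ n *: F n = 0) ->
  forall n, n \in s -> F n = 0.
Proof.
move=> us h l hl; apply/matrixP=> i j; rewrite !mxE.
apply: (exprz_coef_scalar (f := fun n => F n i j) us _ hl) => c c0.
have /matrixP /(_ i j) := h c c0; rewrite summxE mxE => h0.
by rewrite -[RHS]h0; apply: eq_bigr => a _; rewrite mxE.
Qed.
End LaurentCoef.

Section Weights.
Variables (k : closedFieldType) (p r : nat).
Hypotheses (hp : p \in [pchar k]) (r_gt0 : (0 < r)%N).
Local Notation q := (p ^ r)%N.
Local Notation GM := (module (GrT (k := k) p r)).
Implicit Types (A B : comAlgType k) (M N : GM).
Local Notation X := (root_op (k := k) (p := p) (r := r)).

(** The action of the torus on [M] is given by finitely many operators, indexed by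
    the characters: [ws.1 n] is the operator for [n], and [ws.2] contains the
    characters that occur. *)
Definition weight_expansion M (ws : (int -> 'M[k]_(dim M)) * seq int) :=
  [/\ uniq ws.2, forall n, n \notin ws.2 -> ws.1 n = 0 &
    forall A (t : 'M[A]_2), torus t ->
      act M t = \sum_(n <- ws.2) weight_char n t *: base_change A (ws.1 n)].

(** The expansion is read off from the action of the generic point of the torus,
    whose entries are Laurent polynomials. *)
Lemma weight_expansion_exists M : exists ws, @weight_expansion M ws.
Proof.
pose T := act M (tor (ls k) (lsV k)).
have [D hD] : exists D : 'I_(dim M) * 'I_(dim M) -> nat, forall ab,
  exists f, T ab.1 ab.2 = horner_alg (ls k) f * lsV k ^+ D ab.
  apply: (@fin_all_exists _ (fun _ => nat) (fun ab D => exists f,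
    T ab.1 ab.2 = horner_alg (ls k) f * lsV k ^+ D)) => ab; exact: laurent_decomp.
have [f hf] := @fin_all_exists _ (fun _ => {poly k}) (fun ab f =>
    T ab.1 ab.2 = horner_alg (ls k) f * lsV k ^+ D ab) hD.
pose E := (\sum_ab D ab)%N.
have hE ab : (D ab <= E)%N by rewrite /E (bigD1 ab) //= leq_addr.
pose g ab := f ab * 'X^(E - D ab).
have lsn n : ls k ^+ n * lsV k ^+ n = 1 by rewrite -exprMn lsVr expr1n.
have hg a b : T a b = horner_alg (ls k) (g (a, b)) * lsV k ^+ E.
  rewrite -[T a b]/(T (a, b).1 (a, b).2) hf /g rmorphM rmorphXn /= horner_algX.
  rewrite -mulrA; congr (_ * _).
  by rewrite -{2}(subnK (hE (a, b))) exprD mulrA lsn mul1r.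
pose S := (\sum_ab size (g ab))%N.
have hS ab : (size (g ab) <= S)%N by rewrite /S (bigD1 ab) //= leq_addr.
pose P i : 'M[k]_(dim M) := \matrix_(a, b) (g (a, b))`_i.
have P0 i : (S <= i)%N -> P i = 0.
  by move=> hi; apply/matrixP=> a b; rewrite !mxE nth_default // (leq_trans (hS _)).
have HT : T = \sum_(i < S) (ls k ^+ i * lsV k ^+ E) *: base_change (laurent k) (P i).
  apply/matrixP=> a b; rewrite summxE hg.
  have -> : g (a, b) = \sum_(i < S) (g (a, b))`_i *: 'X^i.
    apply/polyP=> i; rewrite coef_sum.
    under eq_bigr => j _ do rewrite coefZ coefXn mulr_natr mulrb.
    case: (ltnP i S) => hi; last first.
      rewrite nth_default ?(leq_trans (hS _)) // big1 // => j _.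
      by rewrite gtn_eqF // (leq_trans _ hi).
    rewrite (bigD1 (Ordinal hi)) //= eqxx big1 ?addr0 // => j.
    by rewrite -val_eqE eq_sym => /negbTE /= ->.
  rewrite rmorph_sum mulr_suml; apply: eq_bigr => i _.
  rewrite -mul_polyC rmorphM rmorphXn /= horner_algC horner_algX !mxE.
  by rewrite -mulrA mulrC.
pose w (n : int) := if n + E%:Z is Posz i then P i else 0.
pose s := [seq i%:Z - E%:Z | i <- iota 0 S].
exists (w, s); split=> /=.
- rewrite map_inj_uniq ?iota_uniq // => i j /addIr; by case.
- move=> n; rewrite /w; case e : (n + E%:Z) => [i|i] // hn; apply: P0.
  rewrite leqNgt; apply: contra hn => hi; apply/mapP; exists i.
    by rewrite mem_iota.
  by rewrite -e addrK.
move=> A t /torusP[a [a' [ha ->]]].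
have [phi [e1 e2]] := laurent_lift ha.
rewrite -e1 -e2 -map_tor act_natural; last first.
  by apply: (GrT_torus r hp); apply: torus_tor; apply: lsVr.
rewrite -/T HT map_expansion.
rewrite big_map (_ : iota 0 S = index_iota 0 S) ?big_mkord; last by rewrite /index_iota subn0.
 apply: eq_bigr => i _.
rewrite map_tor e1 e2 weight_char_tor chi_subn //.
by rewrite rmorphM !rmorphXn /= e1 e2 /w subrK.
Qed.


Definition weight_data M := sval (constructive_indefinite_description _
  (weight_expansion_exists M)).
(** The projection of [M] onto its weight space of weight [n], and a list
    containing all weights. *)
Definition wt_proj M (n : int) : 'M[k]_(dim M) := (weight_data M).1 n.
Local Notation wt := wt_proj.
Definition wsupp M : seq int := (weight_data M).2.

Lemma weight_dataP M : weight_expansion (weight_data M).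
Proof. exact: (svalP (constructive_indefinite_description _ _)). Qed.

Lemma wsupp_uniq M : uniq (wsupp M).
Proof. by case: (weight_dataP M). Qed.

Lemma wt_supp M n : n \notin wsupp M -> wt M n = 0.
Proof. by case: (weight_dataP M) => _ h _; apply: h. Qed.

Lemma act_torus M A (t : 'M[A]_2) s : uniq s -> {subset wsupp M <= s} ->
  torus t -> act M t = \sum_(n <- s) weight_char n t *: base_change A (wt M n).
Proof.
move=> us ss ht; case: (weight_dataP M) => _ _ /(_ A t ht) ->.
apply: big_supp => //; first exact: wsupp_uniq.
by move=> n hn; rewrite -/(wt M n) (wt_supp hn) base_change0 scaler0.
Qed.

(** The action of the [k]-point [diag(c, c ^-1)] of the torus. *)
Definition kpt M (c : k) : 'M[k]_(dim M) := \sum_(n <- wsupp M) c ^ n *: wt M n.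

Lemma kptE M (c : k) s : uniq s -> {subset wsupp M <= s} ->
  kpt M c = \sum_(n <- s) c ^ n *: wt M n.
Proof.
move=> us ss; apply: big_supp => //; first exact: wsupp_uniq.
by move=> n hn; rewrite wt_supp // scaler0.
Qed.

Lemma act_tor_alg M A (c : k) : c != 0 ->
  act M (tor (c%:A : A) (c^-1)%:A) = base_change A (kpt M c).
Proof.
move=> c0; rewrite (@act_torus M A _ (wsupp M)) ?wsupp_uniq //; last first.
  by apply: torus_tor; rewrite mulr_algl scalerA divff // scale1r.
rewrite /kpt base_change_sum; apply: eq_bigr => n _; rewrite base_changeZ.
congr (_ *: _); rewrite weight_char_tor -chi_exprz.
by case: n => i /=; rewrite exprZn expr1n.
Qed.

Lemma wt_sum1 M s : uniq s -> {subset wsupp M <= s} ->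
  \sum_(n <- s) wt M n = 1%:M.
Proof.
move=> us ss; have := act1 M k^o; rewrite -(tor1 k^o).
rewrite (@act_torus M k^o _ s) //; last by apply: torus_tor; rewrite mulr1.
move=> h; rewrite -[RHS]h; apply: eq_bigr => n _.
rewrite base_change_id weight_char_tor.
by case: n => i; rewrite /chi expr1n scale1r.
Qed.

Lemma kptM M c d : c != 0 -> d != 0 -> kpt M c *m kpt M d = kpt M (c * d).
Proof.
move=> c0 d0; have cd0 : c * d != 0 by rewrite mulf_neq0.
have ha (a : k) : a != 0 -> torus (tor (a%:A : k^o) (a^-1)%:A).
  by move=> a0; apply: torus_tor; rewrite mulr_algl scalerA divff // scale1r.
apply: (@base_change_inj k k^o); rewrite base_changeM.
rewrite -(act_tor_alg M k^o c0) -(act_tor_alg M k^o d0).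
rewrite -(act_tor_alg M k^o cd0) -actM; last 2 first.
- exact/(GrT_torus r hp)/ha.
- exact/(GrT_torus r hp)/ha.
rewrite torM; congr (act M (tor _ _)); first by rewrite mulr_algl scalerA.
by rewrite mulr_algl scalerA invfM.
Qed.

(** The weight projections are orthogonal idempotents, because [kpt] is
    multiplicative. *)
Lemma wt_mul M m n : wt M m *m wt M n = if m == n then wt M n else 0.
Proof.
have us := wsupp_uniq M.
case: (boolP (m \in wsupp M)) => hm; last first.
  rewrite (wt_supp hm) mul0mx; case: eqP => // <-; by rewrite wt_supp.
case: (boolP (n \in wsupp M)) => hn; last first.
  by rewrite (wt_supp hn) mulmx0 if_same.
have h1 (d : k) : d != 0 -> wt M m *m kpt M d - d ^ m *: wt M m = 0.
  move=> d0.
  apply: (exprz_coef (F := fun m => wt M m *m kpt M d - d ^ m *: wt M m) us _ hm).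
  move=> c c0; under eq_bigr => l _ do rewrite scalerBr scalemxAl scalerA -expfzMl.
  rewrite sumrB -mulmx_suml -/(kpt M c) kptM //; apply/eqP; rewrite subr_eq0; apply/eqP.
  by apply: eq_bigr => l _.
apply/eqP; rewrite -subr_eq0; apply/eqP.
apply: (exprz_coef (F := fun n => wt M m *m wt M n - if m == n then wt M n else 0) us _ hn).
move=> d d0; rewrite -[RHS](h1 d d0).
under eq_bigr => l _ do rewrite scalerBr scalemxAr.
rewrite sumrB -mulmx_sumr -/(kpt M d); congr (_ - _).
rewrite (bigD1_seq m) //= eqxx big1 ?addr0 // => l /negbTE hl.
by rewrite eq_sym hl scaler0.
Qed.

(** The weight of the [i]-th divided power: [i] times the root, which is 2 for
    the upper and -2 for the lower unipotent group. *)
Definition shift (b : bool) (i : nat) : int := if b then (2 * i)%N%:Z else - (2 * i)%N%:Z.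

Lemma kpt_uni M b c A (x : A) : c != 0 -> x ^+ q = 0 ->
  base_change A (kpt M c) *m act M (uni b x) =
  act M (uni b ((if b then c else c^-1) ^+ 2 *: x)) *m base_change A (kpt M c).
Proof.
move=> c0 hx; pose c' := if b then c else c^-1.
have c'0 : c' != 0 by rewrite /c'; case: (b); rewrite ?invr_eq0.
have tE : torb b (c'%:A : A) (c'^-1)%:A = tor (c%:A : A) (c^-1)%:A.
  by rewrite /torb /c'; case: (b); rewrite // invrK.
have ht : (c'%:A : A) * (c'^-1)%:A = 1 by rewrite mulr_algl scalerA divff // scale1r.
have e1 : (c'%:A ^+ 2 * x : A) = c' ^+ 2 *: x.
  by rewrite exprZn expr1n mulr_algl.
have hx2 : (c' ^+ 2 *: x) ^+ q = 0 by rewrite exprZn hx scaler0.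
have htor : GrT p r (tor (c%:A : A) (c^-1)%:A).
  by rewrite -tE; apply/(GrT_torus r hp)/torus_torb.
have := congr1 (act M (A := A)) (tor_uni b x ht).
by rewrite tE e1 !actM ?act_tor_alg //; apply: (GrT_uni hp).
Qed.

Lemma kpt_X M b i c : c != 0 -> kpt M c *m X M b i = c ^ shift b i *: (X M b i *m kpt M c).
Proof.
move=> c0; have hq := q_gt1 hp r_gt0.
case: (ltnP i q) => hi; last by rewrite (X_ge hp r_gt0) // mulmx0 mul0mx scaler0.
set c' := if b then c else c^-1.
have hx := tx_nilp k hq.
have hx2 : (c' ^+ 2 *: tx k q) ^+ q = 0 by rewrite exprZn hx scaler0.
have := kpt_uni M b c0 hx; rewrite -/c'.
rewrite (act_uni hp r_gt0 M b hx) (act_uni hp r_gt0 M b hx2).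
rewrite base_change_mul_sumr base_change_mul_suml.
move=> /(functional_expansion (functional_coef1 k q i)).
rewrite (sum_tcoef1_Xn (fun j => kpt M c *m X M b j) hq hi) => ->.
rewrite (eq_bigr (fun j : 'I_q => tcoef1 i ((c' ^+ 2) ^+ j *: tx k q ^+ j) *:
    (X M b j *m kpt M c))); last first.
  by move=> j _; rewrite exprZn.
rewrite (sum_tcoef1 (fun j => (c' ^+ 2) ^+ j) (fun j => X M b j *m kpt M c) hq hi).
congr (_ *: _); rewrite -exprM /c' /shift; case: (b) => //.
by rewrite exprVn -exprnN.
Qed.

Lemma wt_X M b i n : wt M n *m X M b i = X M b i *m wt M (n - shift b i).
Proof.
pose e := shift b i.
pose s := undup (n :: wsupp M ++ [seq m + e | m <- wsupp M]).
have us : uniq s by apply: undup_uniq.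
apply/eqP; rewrite -subr_eq0; apply/eqP.
apply: (exprz_coef (F := fun n => wt M n *m X M b i - X M b i *m wt M (n - e)) us);
  last by rewrite mem_undup mem_head.
move=> c c0; under eq_bigr => l _ do rewrite scalerBr scalemxAl scalemxAr.
rewrite sumrB -mulmx_suml -mulmx_sumr -kptE //; last first.
  by move=> m hm; rewrite mem_undup inE mem_cat hm orbT.
rewrite kpt_X // scalemxAr.
suff -> : \sum_(l <- s) c ^ l *: wt M (l - e) = c ^ e *: kpt M c by rewrite subrr.
rewrite scaler_sumr -(big_supp (s := [seq m + e | m <- wsupp M])) //.
- rewrite big_map; apply: eq_bigr => m _.
  by rewrite addrK scalerA -expfzDr // addrC.
- by rewrite map_inj_uniq ?wsupp_uniq // => x y /addIr.
- by move=> m hm; rewrite mem_undup inE mem_cat hm !orbT.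
move=> m hm; rewrite wt_supp ?scaler0 //; apply: contra hm => hm.
by apply/mapP; exists (m - e); rewrite // subrK.
Qed.
End Weights.

(** * Homomorphisms, and the commutation of opposite root vectors *)

Section Homs.
Variables (k : closedFieldType) (p r : nat).
Hypotheses (hp : p \in [pchar k]) (r_gt0 : (0 < r)%N).
Local Notation q := (p ^ r)%N.
Local Notation GM := (module (GrT (k := k) p r)).
Implicit Types (A B : comAlgType k) (M N : GM).
Local Notation X := (root_op (k := k) (p := p) (r := r)).
Local Notation wt := (wt_proj hp).
Let hq : (1 < q)%N := q_gt1 hp r_gt0.

Lemma hom_X M N f b i : @is_hom k _ M N f -> f *m X M b i = X N b i *m f.
Proof.
move=> hf; case: (ltnP i q) => hi; last by rewrite !(X_ge hp r_gt0) // mulmx0 mul0mx.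
have hx := tx_nilp k hq.
have := hf _ _ (GrT_uni hp b hx); rewrite !(act_uni hp r_gt0 _ b hx).
rewrite base_change_mul_sumr base_change_mul_suml.
move=> /(functional_expansion (functional_coef1 k q i)).
by rewrite (sum_tcoef1_Xn (fun j => f *m X M b j) hq hi)
  (sum_tcoef1_Xn (fun j => X N b j *m f) hq hi).
Qed.

Lemma hom_kpt M N f c : @is_hom k _ M N f -> c != 0 ->
  f *m kpt hp M c = kpt hp N c *m f.
Proof.
move=> hf c0; apply: (@base_change_inj k k^o); rewrite !base_changeM.
rewrite -(act_tor_alg hp M k^o c0) -(act_tor_alg hp N k^o c0).
apply: hf; apply: (GrT_torus r hp); apply: torus_tor.
by rewrite mulr_algl scalerA divff // scale1r.
Qed.

Lemma hom_wt M N f n : @is_hom k _ M N f -> f *m wt M n = wt N n *m f.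
Proof.
move=> hf.
pose s := undup (n :: wsupp hp M ++ wsupp hp N).
have us : uniq s by apply: undup_uniq.
apply/eqP; rewrite -subr_eq0; apply/eqP.
apply: (exprz_coef (F := fun n => f *m wt M n - wt N n *m f) us);
  last by rewrite mem_undup mem_head.
move=> c c0; under eq_bigr => l _ do rewrite scalerBr scalemxAr scalemxAl.
rewrite sumrB -mulmx_sumr -mulmx_suml -!kptE //.
- by rewrite hom_kpt // subrr.
- by move=> m hm; rewrite mem_undup inE mem_cat hm !orbT.
by move=> m hm; rewrite mem_undup inE mem_cat hm !orbT.
Qed.

(** Operators that commute with the divided powers and the weight projections are
    equivariant, by the factorisation of the points of G_r T. *)
Lemma hom_of_ops M N (f : 'M[k]_(dim N, dim M)) :
  (forall b i, f *m X M b i = X N b i *m f) ->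
  (forall n, f *m wt M n = wt N n *m f) -> is_hom f.
Proof.
move=> hX hw A g hg.
have huni b (a : A) : a ^+ q = 0 ->
  base_change A f *m act M (uni b a) = act N (uni b a) *m base_change A f.
  move=> ha; rewrite !(act_uni hp r_gt0 _ b ha) base_change_mul_sumr base_change_mul_suml.
  by apply: eq_bigr => i _; rewrite hX.
have htor (t t' : A) : t * t' = 1 ->
  base_change A f *m act M (tor t t') = act N (tor t t') *m base_change A f.
  move=> /torus_tor ht.
  pose s := undup (wsupp hp M ++ wsupp hp N).
  have us : uniq s by apply: undup_uniq.
  rewrite (act_torus (hp := hp) us _ ht); last first.
    by move=> m hm; rewrite mem_undup mem_cat hm.
  rewrite (act_torus (hp := hp) us _ ht); last first.
    by move=> m hm; rewrite mem_undup mem_cat hm orbT.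
  rewrite base_change_mul_sumr base_change_mul_suml.
  by apply: eq_bigr => i _; rewrite hw.
have [u [t [t' [h1 h2 h3 ->]]]] := GrT_factor hp true hg.
have g1 := GrT_uni hp true h2; have g2 := GrT_uni hp (~~ true) h3.
have g3 := GrT_torus r hp (torus_tor h1).
have g4 := GrTM hp g3 g2.
rewrite !(actM _ g1 g4) !(actM _ g3 g2).
rewrite mulmxA huni // -mulmxA [base_change A f *m _]mulmxA htor //.
by rewrite -[_ *m base_change A f *m _]mulmxA huni // !mulmxA.
Qed.

Lemma act_wt M n A (t : 'M[A]_2) : torus t ->
  act M t *m base_change A (wt M n) = weight_char n t *: base_change A (wt M n).
Proof.
move=> ht; pose s := undup (n :: wsupp hp M).
have us : uniq s by apply: undup_uniq.
rewrite (act_torus (hp := hp) us _ ht); last first.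
  by move=> m hm; rewrite mem_undup inE hm orbT.
rewrite base_change_mul_suml (bigD1_seq n) //=; last by rewrite mem_undup mem_head.
rewrite wt_mul eqxx big1 ?addr0 // => m /negbTE hm.
by rewrite wt_mul hm base_change0 scaler0.
Qed.

(** A vector killed by the divided powers of a root vector is fixed by the
    unipotent group. *)
Lemma act_uni_fixed M b m (v : 'M[k]_(dim M, m)) A (x : A) :
  (forall i, (0 < i)%N -> X M b i *m v = 0) -> x ^+ q = 0 ->
  act M (uni b x) *m base_change A v = base_change A v.
Proof.
move=> hv hx; rewrite (act_uni hp r_gt0 _ b hx) base_change_mul_suml.
have q0 := q_gt0 r hp.
rewrite (bigD1 (Ordinal q0)) //= expr0 scale1r (X0 hp r_gt0) mul1mx big1 ?addr0 //.
move=> i hi; rewrite hv ?base_change0 ?scaler0 //.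
by rewrite lt0n; exact: hi.
Qed.

Lemma invariant_fixed M m (v : 'M[k]_(dim M, m)) :
  (forall b i, (0 < i)%N -> X M b i *m v = 0) -> wt M 0 *m v = v ->
  forall A (g : 'M[A]_2), GrT p r g -> act M g *m base_change A v = base_change A v.
Proof.
move=> hX hw A g hg.
have [a [t [t' [h1 h2 h3 ->]]]] := GrT_factor hp true hg.
have g1 := GrT_uni hp true h2; have g2 := GrT_uni hp (~~ true) h3.
have ht := torus_tor h1; have g3 := GrT_torus r hp ht; have g4 := GrTM hp g3 g2.
rewrite (actM _ g1 g4) (actM _ g3 g2) -!mulmxA.
rewrite (act_uni_fixed (hX _) h3).
have e : act M (tor t t') *m base_change A v = base_change A v.
  rewrite -hw base_changeM mulmxA act_wt //.
  by rewrite (_ : weight_char 0 (tor t t') = 1) // scale1r.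
by rewrite e (act_uni_fixed (hX _) h2).
Qed.

Lemma act_uni_vec M b m (v : 'M[k]_(dim M, m)) A (x : A) : x ^+ q = 0 ->
  act M (uni b x) *m base_change A v =
  \sum_(i < q) x ^+ i *: base_change A (X M b i *m v).
Proof. by move=> hx; rewrite (act_uni hp r_gt0 _ b hx) base_change_mul_suml. Qed.

Lemma act_uni2_vec M b c m (v : 'M[k]_(dim M, m)) A (x y : A) :
  x ^+ q = 0 -> y ^+ q = 0 ->
  act M (uni b x) *m (act M (uni c y) *m base_change A v) =
  \sum_(i < q) \sum_(j < q) (x ^+ i * y ^+ j) *:
     base_change A (X M b i *m (X M c j *m v)).
Proof.
by move=> hx hy; rewrite act_uni_vec // (act_uni hp r_gt0 _ b hx) mul_expansion.
Qed.

(** The action of [uni_swap] on a weight vector fixed by [uni b]. *)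
Lemma act_swap M b m (v : 'M[k]_(dim M, m)) lam A (x y w w' : A) :
  (forall i, (0 < i)%N -> X M b i *m v = 0) -> wt M lam *m v = v ->
  x ^+ q = 0 -> y ^+ q = 0 -> w = 1 + x * y -> w * w' = 1 ->
  act M (uni b x) *m (act M (uni (~~ b) y) *m base_change A v) =
  weight_char lam (torb b w w') *: (act M (uni (~~ b) (y * w')) *m base_change A v).
Proof.
move=> hv hw hx hy hwE hww.
have hx' : (x * w') ^+ q = 0 by rewrite exprMn hx mul0r.
have hy' : (y * w') ^+ q = 0 by rewrite exprMn hy mul0r.
have g1 := GrT_uni hp b hx; have g2 := GrT_uni hp (~~ b) hy.
have g3 := GrT_uni hp b hx'; have g4 := GrT_uni hp (~~ b) hy'.
have ht := torus_torb b hww; have g5 := GrT_torus r hp ht.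
have g6 := GrTM hp g5 g3.
rewrite mulmxA -actM // (uni_swap b hwE hww) (actM _ g4 g6) (actM _ g5 g3).
have e : act M (torb b w w') *m base_change A v =
  weight_char lam (torb b w w') *: base_change A v.
  by rewrite -hw base_changeM mulmxA act_wt // -scalemxAl.
by rewrite -!mulmxA (act_uni_fixed hv hx') e -scalemxAr.
Qed.

(** Comparing the coefficients of [x ^ i * y ^ j] in [act_swap] expresses
    [X b i *m X (~~ b) j] through the [X (~~ b) l] on such a vector.  Here [w]
    has inverse [w ^+ q.-1], as [w ^+ q = 1]. *)
Lemma X_swap M b m (v : 'M[k]_(dim M, m)) lam i j (w : truncxy k q) :
  w = 1 + ty1 k q * ty2 k q ->
  (forall i, (0 < i)%N -> X M b i *m v = 0) -> wt M lam *m v = v ->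
  (i < q)%N -> (j < q)%N ->
  X M b i *m (X M (~~ b) j *m v) =
  \sum_(l < q) tcoef2 i j (weight_char lam (torb b w (w ^+ q.-1))
     * (ty2 k q * w ^+ q.-1) ^+ l) *: (X M (~~ b) l *m v).
Proof.
move=> hwE hv hw hi hj.
have hx := ty1_nilp k hq; have hy := ty2_nilp k hq.
have hww : w * w ^+ q.-1 = 1.
  rewrite -exprS prednK ?(q_gt0 r hp) // hwE (exprDq r hp) exprMn hx mul0r.
  by rewrite expr1n addr0.
have := act_swap hv hw hx hy hwE hww.
have hy' : (ty2 k q * w ^+ q.-1) ^+ q = 0 by rewrite exprMn hy mul0r.
rewrite (act_uni2_vec b (~~ b) v hx hy) (act_uni_vec (~~ b) v hy') scale_expansion.
move=> /(functional_expansion2 (functional_coef2 k q i j)) <-.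
rewrite (bigD1 (Ordinal hi)) //= (bigD1 (Ordinal hj)) //=.
rewrite tcoef2_monom // !eqxx scale1r big1 ?addr0; last first.
  move=> l hl; rewrite tcoef2_monom // eqxx /= eq_sym.
  by rewrite (negbTE (hl : (l != j :> nat))) scale0r.
rewrite big1 ?addr0 // => a ha; rewrite big1 // => l _.
by rewrite tcoef2_monom // eq_sym (negbTE (ha : (a != i :> nat))) scale0r.
Qed.

Lemma X_swap_span M b m (v : 'M[k]_(dim M, m)) lam i j :
  (forall i, (0 < i)%N -> X M b i *m v = 0) -> wt M lam *m v = v ->
  exists c : nat -> k,
  X M b i *m (X M (~~ b) j *m v) = \sum_(l < q) c l *: (X M (~~ b) l *m v).
Proof.
move=> hv hw.
case: (ltnP i q) => hi; last first.
  exists (fun=> 0); rewrite (X_ge hp r_gt0) // mul0mx big1 // => l _.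
  by rewrite scale0r.
case: (ltnP j q) => hj; last first.
  exists (fun=> 0); rewrite (X_ge hp r_gt0 _ _ hj) // mul0mx mulmx0 big1 // => l _.
  by rewrite scale0r.
pose w := 1 + ty1 k q * ty2 k q.
exists (fun l => tcoef2 i j (weight_char lam (torb b w (w ^+ q.-1))
     * (ty2 k q * w ^+ q.-1) ^+ l)).
by rewrite (X_swap erefl hv hw hi hj).
Qed.

Lemma tcoef2_swap (w : truncxy k q) i j l e : w = 1 + ty1 k q * ty2 k q ->
  (i < q)%N -> (j < q)%N ->
  tcoef2 i j (ty2 k q ^+ l * w ^+ e) = ((j == l + i)%N * 'C(e, i))%:R.
Proof.
move=> -> hi hj; rewrite exprDn mulr_sumr (functional_sum _ _ _ (functional_coef2 k q i j)).
have E (m : 'I_e.+1) : tcoef2 i j (ty2 k q ^+ l *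
   (1 ^+ (e - m) * (ty1 k q * ty2 k q) ^+ m *+ 'C(e, m))) =
   (((i == m) && (j == l + m))%N * 'C(e, m))%:R.
  rewrite expr1n mul1r mulrnAr exprMn mulrCA -exprD.
  by rewrite (tcoef2_monom' hp r_gt0).
rewrite (eq_bigr _ (fun m _ => E m)).
case: (leqP i e) => hie; last first.
  rewrite bin_small // muln0 big1 // => m _.
  by rewrite gtn_eqF // (leq_ltn_trans _ hie) // -ltnS.
rewrite (bigD1 (Ordinal (hie : (i < e.+1)%N))) //= eqxx big1 ?addr0 // => m hm.
by rewrite eq_sym (negbTE (hm : (m != i :> nat))).
Qed.

(** The lowest vector of the submodule generated by a vector of weight
    [2 (q - 1)] killed by the positive root vectors is invariant. *)
Lemma X_top M m (v : 'M[k]_(dim M, m)) i :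
  (forall i, (0 < i)%N -> X M true i *m v = 0) ->
  wt M (2 * q.-1)%N%:Z *m v = v -> (0 < i)%N ->
  X M true i *m (X M false q.-1 *m v) = 0.
Proof.
move=> hv hw i0; case: (ltnP i q) => hi; last by rewrite (X_ge hp r_gt0) // mul0mx.
have q0 := q_gt0 r hp.
have hq1 : (q.-1 < q)%N by rewrite prednK.
have [w wE] : exists w, w = 1 + ty1 k q * ty2 k q by eexists.
rewrite (X_swap wE hv hw hi hq1) big1 // => l _.
have wq : w ^+ q = 1.
  by rewrite wE (exprDq r hp) exprMn (ty1_nilp k hq) mul0r expr1n addr0.
suff -> : tcoef2 i q.-1 (weight_char (2 * q.-1)%N%:Z (torb true w (w ^+ q.-1)) *
   (ty2 k q * w ^+ q.-1) ^+ l) = 0 by rewrite scale0r.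
rewrite weight_char_tor /chi exprMn -exprM mulrCA -exprD.
(* Only [l = q - 1 - i] contributes by degree; then the exponent of [w]
   is congruent to [i - 1] modulo [q], so [x ^ i] does not occur in it. *)
case: (eqVneq q.-1 (l + i)%N) => e; last first.
  by rewrite tcoef2_swap // (negbTE e).
have -> : (2 * q.-1 + q.-1 * l)%N = (q * l.+1 + i.-1)%N.
  have gen Q L : Q = (L + i).+1 -> (2 * Q.-1 + Q.-1 * L = Q * L.+1 + i.-1)%N.
    by move=> ->; case: i i0 {hi e} => //= i _; nia.
  by apply: gen; rewrite -e prednK.
by rewrite exprD exprM wq expr1n mul1r tcoef2_swap // bin_small ?muln0 // prednK.
Qed.
(** The operator F_(q-1) E_(q-1) maps vectors of weight zero to invariant
    vectors. *)
Lemma integral_invariant M m (v u : 'M[k]_(dim M, m)) : wt M 0 *m v = v ->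
  u = X M false q.-1 *m (X M true q.-1 *m v) ->
  (forall b i, (0 < i)%N -> X M b i *m u = 0) /\ wt M 0 *m u = u.
Proof.
move=> w0 uE; have q0 := q_gt0 r hp.
have Xkill b i n (x : 'M[k]_(dim M, n)) : (0 < i)%N -> X M b i *m (X M b q.-1 *m x) = 0.
  move=> i0; rewrite mulmxA (X_mul hp r_gt0) (X_ge hp r_gt0) ?scaler0 ?mul0mx //.
  by rewrite -{1}(prednK q0) -add1n leq_add2r.
have w1 : wt M (2 * q.-1)%N *m (X M true q.-1 *m v) = X M true q.-1 *m v.
  by rewrite mulmxA wt_X // subrr -mulmxA w0.
split=> [b i i0|]; rewrite uE; last first.
  rewrite mulmxA wt_X // -mulmxA; congr (_ *m _).
  by rewrite /shift sub0r opprK w1.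
case: b; last exact: Xkill.
by apply: X_top => // j j0; apply: Xkill.
Qed.
End Homs.

(** * The module of linear maps and the relative trace *)

Section LinMx.
Variable R : comNzRingType.

Lemma mxvec_ext m n l (P Q : 'M[R]_(m * n, l)) :
  (forall u : 'M_(m, n), mxvec u *m P = mxvec u *m Q) -> P = Q.
Proof.
by move=> h; apply/row_matrixP=> i; rewrite !rowE -(vec_mxK (delta_mx 0 i)).
Qed.

(** The matrix of [u |-> B *m u *m C] on column vectors. *)
Definition conj_mx m n (B : 'M[R]_m) (C : 'M[R]_n) : 'M[R]_(m * n) :=
  (lin_mx (mulmxr C \o mulmx B))^T.

(** A matrix as a column vector. *)
Definition cvec m n (u : 'M[R]_(m, n)) : 'cV[R]_(m * n) := (mxvec u)^T.

Lemma cvec_inj m n : injective (@cvec m n).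
Proof. by move=> u v /trmx_inj /(can_inj mxvecK). Qed.

Lemma cvecZ m n a (u : 'M[R]_(m, n)) : cvec (a *: u) = a *: cvec u.
Proof. by rewrite /cvec !linearZ. Qed.

Lemma cvec_sum m n I (s : seq I) (F : I -> 'M[R]_(m, n)) :
  cvec (\sum_(i <- s) F i) = \sum_(i <- s) cvec (F i).
Proof. by rewrite /cvec !linear_sum. Qed.

Lemma conj_mxE m n (B : 'M[R]_m) (C : 'M[R]_n) u :
  conj_mx B C *m cvec u = cvec (B *m u *m C).
Proof. by rewrite -trmx_mul mul_vec_lin. Qed.

Lemma conj_mx1 m n : @conj_mx m n 1%:M 1%:M = 1%:M.
Proof.
apply: trmx_inj; rewrite trmx1; apply: mxvec_ext => u.
by rewrite trmxK mul_vec_lin /= mulmx1 mul1mx mulmx1.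
Qed.

Lemma conj_mxM m n (B B' : 'M[R]_m) (C C' : 'M[R]_n) :
  conj_mx (B *m B') (C' *m C) = conj_mx B C *m conj_mx B' C'.
Proof.
apply: trmx_inj; apply: mxvec_ext => u.
by rewrite trmx_mul !trmxK mulmxA !mul_vec_lin /= !mulmxA.
Qed.
End LinMx.

Lemma map_conj_mx (R S : comNzRingType) (f : {rmorphism R -> S}) m n
  (B : 'M[R]_m) (C : 'M[R]_n) :
  map_mx f (conj_mx B C) = conj_mx (map_mx f B) (map_mx f C).
Proof.
apply: trmx_inj; rewrite -map_trmx !trmxK; apply/row_matrixP => i.
rewrite -map_row !rowE -(map_delta_mx f) -[delta_mx 0 i]vec_mxK map_mxvec.
by rewrite !mul_vec_lin map_mxvec /= !map_mxM.
Qed.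

Lemma map_cvec (R S : comNzRingType) (f : {rmorphism R -> S}) m n
  (u : 'M[R]_(m, n)) : map_mx f (cvec u) = cvec (map_mx f u).
Proof. by rewrite /cvec -map_trmx map_mxvec. Qed.

Section HomModule.
Variables (k : closedFieldType) (p r : nat).
Hypotheses (hp : p \in [pchar k]) (r_gt0 : (0 < r)%N).
Local Notation q := (p ^ r)%N.
Local Notation GM := (module (GrT (k := k) p r)).
Implicit Types (A B : comAlgType k) (L M N : GM).
Local Notation X := (root_op (k := k) (p := p) (r := r)).
Local Notation wt := (wt_proj hp).
Let hq : (1 < q)%N := q_gt1 hp r_gt0.

Definition hom_act L M A (g : 'M[A]_2) : 'M[A]_(dim M * dim L) :=
  conj_mx (act M g) (act L (\adj g)).

Lemma hom_act_natural L M A B (phi : {lrmorphism A -> B}) (g : 'M[A]_2) :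
  GrT p r g -> hom_act L M (map_mx phi g) = map_mx phi (hom_act L M g).
Proof.
move=> hg; have hg' := GrT_adj hp hg.
by rewrite /hom_act -map_mx_adj !act_natural // -map_conj_mx.
Qed.

Lemma hom_act1 L M A : @hom_act L M A 1%:M = 1%:M.
Proof. by rewrite /hom_act adj1 !act1 conj_mx1. Qed.

Lemma adjM2 A (g h : 'M[A]_2) : \adj (g *m h) = \adj h *m \adj g.
Proof. by rewrite !adj2 mulmx2 !mulmx2E; congr mx2; ring. Qed.

Lemma hom_actM L M A (g h : 'M[A]_2) : GrT p r g -> GrT p r h ->
  hom_act L M (g *m h) = hom_act L M g *m hom_act L M h.
Proof.
move=> hg hh; have hg' := GrT_adj hp hg; have hh' := GrT_adj hp hh.
by rewrite /hom_act adjM2 !actM // conj_mxM.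
Qed.

(** The space of linear maps from [L] to [M], with the action by conjugation;
    its elements are encoded as columns by [cvec]. *)
Definition hom_module L M : GM :=
  Module (@hom_act_natural L M) (@hom_act1 L M) (@hom_actM L M).

Lemma act_hom_module L M A (g : 'M[A]_2) (u : 'M[k]_(dim M, dim L)) :
  act (hom_module L M) g *m base_change A (cvec u) =
  cvec (act M g *m base_change A u *m act L (\adj g)).
Proof. by rewrite /base_change map_cvec; apply: conj_mxE. Qed.

(** The conjugation action of the divided powers on a linear map, see
    [X_hom_module]. *)
Definition adX L M b n (u : 'M[k]_(dim M, dim L)) : 'M[k]_(dim M, dim L) :=
  \sum_(i < q) \sum_(j < q)
    (if (i + j == n)%N then (-1) ^+ j else 0) *: (X M b i *m u *m X L b j).

Lemma act_uni_hom_module L M b (u : 'M[k]_(dim M, dim L)) A (x : A) : x ^+ q = 0 ->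
  act (hom_module L M) (uni b x) *m base_change A (cvec u) =
  \sum_(i < q) \sum_(j < q) (x ^+ i * (- x) ^+ j) *:
    base_change A (cvec (X M b i *m u *m X L b j)).
Proof.
move=> hx; rewrite act_hom_module adj_uni.
have hx' : (- x) ^+ q = 0 by rewrite exprNn hx mulr0.
rewrite (act_uni hp r_gt0 M b hx) (act_uni hp r_gt0 L b hx').
rewrite base_change_mul_suml mul_expansion cvec_sum.
apply: eq_bigr => i _; rewrite cvec_sum; apply: eq_bigr => j _.
by rewrite cvecZ /base_change -map_cvec.
Qed.

Lemma sign_scale A j (z : A) : (-1) ^+ j * z = (-1) ^+ j *: z.
Proof. by elim: j => [|j IH]; rewrite ?mul1r ?scale1r // !exprS !mulN1r scaleNr mulNr IH. Qed.

Lemma X_hom_module L M b n (u : 'M[k]_(dim M, dim L)) : (n < q)%N ->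
  X (hom_module L M) b n *m cvec u = cvec (adX b n u).
Proof.
move=> hn; have hx := tx_nilp k hq.
have := act_uni_hom_module b u hx; rewrite (act_uni_vec hp r_gt0 b _ hx) => /esym.
move=> /(functional_expansion2 (functional_coef1 k q n)).
rewrite (sum_tcoef1_Xn (fun j => X (hom_module L M) b j *m cvec u) hq hn) => <-.
rewrite /adX cvec_sum; apply: eq_bigr => i _.
rewrite cvec_sum; apply: eq_bigr => j _; rewrite cvecZ; congr (_ *: _).
rewrite -[- tx _ _]mulN1r exprMn mulrCA -exprD.
rewrite sign_scale tcoef1Z; case: (ltnP (i + j) q) => hij.
  by rewrite tcoef1Xn // eq_sym; case: eqP; rewrite ?mulr1 ?mulr0.
rewrite -(subnK hij) exprD hx mulr0 tcoef1_0 mulr0 subnK //.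
by rewrite gtn_eqF // (leq_trans hn).
Qed.

Lemma kpt_comm L M (u : 'M[k]_(dim M, dim L)) c :
  (forall n, wt M n *m u = u *m wt L n) -> kpt hp M c *m u = u *m kpt hp L c.
Proof.
move=> hu; pose s := undup (wsupp hp L ++ wsupp hp M).
have us : uniq s by apply: undup_uniq.
rewrite (kptE _ us); last by move=> n hn; rewrite mem_undup mem_cat hn orbT.
rewrite (kptE _ us); last by move=> n hn; rewrite mem_undup mem_cat hn.
rewrite mulmx_suml mulmx_sumr; apply: eq_bigr => n _.
by rewrite -scalemxAl -scalemxAr hu.
Qed.

Lemma kpt1 M : kpt hp M 1 = 1%:M.
Proof.
rewrite -(wt_sum1 (hp := hp) (wsupp_uniq hp M) (fun _ h => h)).
by apply: eq_bigr => n _; rewrite exp1rz scale1r.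
Qed.

Lemma wt_hom_module L M (u : 'M[k]_(dim M, dim L)) :
  (forall n, wt M n *m u = u *m wt L n) ->
  wt (hom_module L M) 0 *m cvec u = cvec u.
Proof.
move=> hu; set H := hom_module L M.
have hk c : c != 0 -> kpt hp H c *m cvec u = cvec u.
  move=> c0; have ci0 : c^-1 != 0 by rewrite invr_eq0.
  apply: (@base_change_inj k k^o); rewrite base_changeM.
  rewrite -(act_tor_alg hp H k^o c0) act_hom_module adj_tor.
  rewrite (act_tor_alg hp M k^o c0).
  have := act_tor_alg hp L k^o ci0; rewrite invrK => ->.
  rewrite -!base_changeM kpt_comm // -mulmxA kptM // divff // kpt1 mulmx1.
  by rewrite /base_change map_cvec.
pose s := undup (0 :: wsupp hp H).
have us : uniq s by apply: undup_uniq.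
have h0 : 0 \in s by rewrite mem_undup mem_head.
apply/eqP; rewrite -subr_eq0; apply/eqP.
pose F n := wt H n *m cvec u - (if n == 0 then cvec u else 0).
suff hF c : c != 0 -> \sum_(n <- s) c ^ n *: F n = 0.
  exact: (exprz_coef us hF h0).
move=> c0; under eq_bigr => l _ do rewrite /F scalerBr scalemxAl.
rewrite sumrB -mulmx_suml -kptE //; last first.
  by move=> m hm; rewrite mem_undup inE hm orbT.
rewrite hk // (bigD1_seq 0) //= expr0z scale1r big1 ?addr0 ?subrr //.
by move=> l /negbTE ->; rewrite scaler0.
Qed.

(** The invariants of [hom_module L M] are the homomorphisms. *)
Lemma invariant_hom L M (u : 'M[k]_(dim M, dim L)) :
  (forall b i, (0 < i)%N -> X (hom_module L M) b i *m cvec u = 0) ->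
  wt (hom_module L M) 0 *m cvec u = cvec u -> is_hom u.
Proof.
move=> hX hw A g hg.
have fixg := invariant_fixed r_gt0 hX hw hg.
move: fixg; rewrite act_hom_module /base_change map_cvec => /cvec_inj e.
have hg' := GrT_adj hp hg.
by rewrite -{1}e -mulmxA -actM // (GrT_mulVg hg) act1 mulmx1.
Qed.

(** The relative trace: F_(q-1) E_(q-1) applied to a linear map, for the
    conjugation action.  On the maps commuting with the torus it has the role of
    averaging over G_r. *)
Definition relative_trace L M (u : 'M[k]_(dim M, dim L)) := adX false q.-1 (adX true q.-1 u).

Lemma trace_hom L M (u : 'M[k]_(dim M, dim L)) :
  (forall n, wt M n *m u = u *m wt L n) -> is_hom (relative_trace u).
Proof.
move=> hu; have hq1 : (q.-1 < q)%N by rewrite prednK ?(q_gt0 r hp).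
have e : cvec (relative_trace u) = X (hom_module L M) false q.-1 *m
    (X (hom_module L M) true q.-1 *m cvec u).
  have e1 := X_hom_module true u hq1.
  have e2 := X_hom_module false (adX true q.-1 u) hq1.
  exact: (esym (etrans (congr1 (mulmx _) e1) e2)).
have [h1 h2] := integral_invariant r_gt0 (wt_hom_module hu) e.
exact: (invariant_hom h1 h2).
Qed.
End HomModule.

(** * Functionals on induced modules *)

Section Induced.
Variables (k : closedFieldType) (p r : nat).
Hypotheses (hp : p \in [pchar k]) (r_gt0 : (0 < r)%N).
Local Notation q := (p ^ r)%N.
Local Notation GM := (module (GrT (k := k) p r)).
Implicit Types (A B : comAlgType k) (L M N Q : GM).
Local Notation X := (root_op (k := k) (p := p) (r := r)).
Local Notation wt := (wt_proj hp).
Let hq : (1 < q)%N := q_gt1 hp r_gt0.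

(** Functionals that are eigenvectors of all points [kpt] have a weight. *)
Lemma kpt_eigen M m (phi : 'M[k]_(m, dim M)) n :
  (forall c, c != 0 -> phi *m kpt hp M c = c ^ n *: phi) ->
  forall l, phi *m wt M l = if l == n then phi else 0.
Proof.
move=> h l; pose s := undup (l :: n :: wsupp hp M).
have us : uniq s by apply: undup_uniq.
have hn : n \in s by rewrite mem_undup !inE eqxx orbT.
have hl : l \in s by rewrite mem_undup mem_head.
pose F l := phi *m wt M l - (if l == n then phi else 0).
suff hF c : c != 0 -> \sum_(l <- s) c ^ l *: F l = 0.
  by apply/eqP; rewrite -subr_eq0; apply/eqP; exact: (exprz_coef us hF hl).
move=> c0; under eq_bigr => j _ do rewrite /F scalerBr scalemxAr.
rewrite sumrB -mulmx_sumr -kptE //; last first.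
  by move=> m' hm; rewrite mem_undup !inE hm !orbT.
rewrite h // (bigD1_seq n) //= eqxx big1 ?addr0 ?subrr //.
by move=> j /negbTE ->; rewrite scaler0.
Qed.

(** The subgroup of G_r T that is complementary to the unipotent group [uni b]:
    [B_r T] for the upper one and its opposite for the lower one. *)
Definition parab b : point_functor k := if b then BrT p r else BrplusT p r.

Lemma parabP b A (h : 'M[A]_2) : parab b h <-> off b h = 0 /\ GrT p r h.
Proof.
case: b; rewrite /parab /BrT /BrplusT /borel /borel_plus /GrT /SL2 /off.
  by split=> [[[? ?] ?]|[? [? ?]]].
by split=> [[[? ?] ?]|[? [? ?]]].
Qed.

Lemma parab_uni b A (x : A) : x ^+ q = 0 -> parab b (uni (~~ b) x).
Proof.
move=> hx; apply/parabP; split; last exact: (GrT_uni hp).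
by case: b; rewrite /off /uni /= mx2E.
Qed.

Lemma parab_torus b A (h : 'M[A]_2) : torus h -> parab b h.
Proof.
move=> ht; apply/parabP; split; last exact: (GrT_torus r hp).
by case: ht => _ h1 h2; case: b.
Qed.

Lemma parabM b A (g h : 'M[A]_2) : parab b g -> parab b h -> parab b (g *m h).
Proof.
move=> /parabP[g1 g2] /parabP[h1 h2]; apply/parabP; split; last exact: GrTM.
by case: b g1 h1 => /=; rewrite mulmx2E => -> ->; rewrite mulr0 mul0r addr0.
Qed.

Lemma parab_adj b A (h : 'M[A]_2) : parab b h -> parab b (\adj h).
Proof.
move=> /parabP[h1 h2]; apply/parabP; split; last exact: GrT_adj.
by case: b h1 => /= h1; rewrite adj2 mx2E h1 oppr0.
Qed.

Lemma weight_char_adj A n (h : 'M[A]_2) : weight_char (- n) (\adj h) = weight_char n h.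
Proof. by rewrite !weight_charE adj2 !mx2E chiN. Qed.

Lemma nilp_mul_exp A (b z u : A) m : b ^+ q = 0 ->
  b ^+ q.-1 * (z + b * u) ^+ m = b ^+ q.-1 * z ^+ m.
Proof.
move=> hb; elim: m => // m IH.
have e : b * b ^+ q.-1 = 0 by rewrite -exprS prednK ?(q_gt0 r hp).
rewrite !exprS mulrCA IH; move: (b ^+ q.-1) (z ^+ m) e => c d e.
by apply: (eq_mod (c := u * d) e); ring.
Qed.

(** The section of the induced module supported by the top power of the
    coordinate of [uni b]. *)
Definition top_section b (n : int) A (x : 'M[A]_2) : A :=
  off b x ^+ q.-1 *
  weight_char (- n + (if b then q.-1%:Z else - q.-1%:Z)) x.

Lemma top_section_ind b n : ind_section (GrT p r) (parab b) n (top_section b n).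
Proof.
split=> [A B phi x _|A x h hx hh].
  rewrite /top_section !weight_charE rmorphM rmorphXn /= map_chi !mxE.
  by congr (_ ^+ _ * _); case: b; rewrite /off ?mxE.
have [_ x1 x2] := (GrTP r hp x).1 hx.
have /parabP[hoff hG] := hh.
have [hdet _ _] := (GrTP r hp h).1 hG.
rewrite /top_section !weight_charE.
set m := _ + _.
have hss : h 0 0 * h 1 1 = 1.
  by move: hdet; rewrite det2; case: (b) hoff => /= ->; rewrite ?mul0r ?mulr0 subr0.
have hm : chi (- n) (h 0 0) (h 1 1) =
    chi m (h 0 0) (h 1 1) * (if b then h 1 1 else h 0 0) ^+ q.-1.
  have -> : - n = m + (if b then - q.-1%:Z else q.-1%:Z).
    by rewrite /m; case: (b); rewrite ?addrK ?subrK.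
  by rewrite chiD //; congr (_ * _); case: (b); rewrite ?chiN.
rewrite hm.
have offM : off b (x *m h) = off b x * (if b then h 1 1 else h 0 0).
  by case: (b) hoff => /= e; rewrite mulmx2E e mulr0 ?add0r ?addr0.
rewrite offM exprMn.
have -> : off b x ^+ q.-1 * (if b then h 1 1 else h 0 0) ^+ q.-1 *
    chi m ((x *m h) 0 0) ((x *m h) 1 1) =
   off b x ^+ q.-1 * (if b then h 1 1 else h 0 0) ^+ q.-1 *
    chi m (x 0 0 * h 0 0) (x 1 1 * h 1 1).
  rewrite !mulmx2E [off b x ^+ _ * _]mulrC -!mulrA; congr (_ * _).
  case: (b) hoff {hm offM} => /= e; rewrite e ?mulr0 ?addr0 ?add0r; case: m => i //=.
    exact: nilp_mul_exp.
  by rewrite addrC; exact: nilp_mul_exp.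
rewrite chiM; ring.
Qed.

(** A module induced from the character [n] of [parab b] carries a functional
    [eps], the evaluation of sections at the identity.  It has weight [n], is
    killed by the divided powers in [parab b], and its translates by those of
    [uni b] separate the vectors, since sections are determined by their values
    on [uni b].  The vector [y] comes from [top_section], the section with value
    [x ^ (q - 1)] at [uni b x]. *)
Lemma Ind_functional b n Q : is_Ind (parab b) n Q ->
  exists (eps : 'rV[k]_(dim Q)) (y : 'cV[k]_(dim Q)), [/\
    forall i, (0 < i)%N -> eps *m X Q (~~ b) i = 0,
    forall m, eps *m wt Q m = if m == n then eps else 0,
    forall v : 'cV_(dim Q), (forall i, eps *m X Q b i *m v = 0) -> v = 0 &
    forall i, eps *m X Q b i *m y = (i == q.-1)%:R%:M].
Proof.
case=> f [f_ind f_basis f_act].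
pose eps : 'rV[k]_(dim Q) := \row_j (f j k^o 1%:M : k).
have G1 A : GrT p r (1%:M : 'M[A]_2) := GrT1 r hp A.
have epsA A : base_change A eps = \row_j f j A 1%:M.
  have [psi hpsi] := alg_lrmorphism A.
  apply/rowP=> j; rewrite !mxE.
  by have := (f_ind j).1 _ _ psi 1%:M (G1 _); rewrite map_mx1 hpsi => ->.
have fadj A (g : 'M[A]_2) j : GrT p r g -> f j A (\adj g) = (base_change A eps *m act Q g) 0 j.
  move=> hg; rewrite -[\adj g]mulmx1 f_act // epsA mxE.
  by apply: eq_bigr => i _; rewrite mxE mulrC.
have eps_parab A (h : 'M[A]_2) : parab b h ->
    base_change A eps *m act Q h = weight_char n h *: base_change A eps.
  move=> hh; have hG : GrT p r h by case/parabP: hh.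
  apply/rowP=> j; rewrite -fadj // -[\adj h]mul1mx (f_ind j).2 //; last exact: parab_adj.
  by rewrite weight_char_adj mxE epsA mxE.
have eps_uni A (a : A) (v : 'cV[k]_(dim Q)) : a ^+ q = 0 ->
  \sum_j v j 0 *: f j A (uni b a) =
  (\sum_(i < q) (- a) ^+ i *: base_change A (eps *m X Q b i *m v)) 0 0.
  move=> ha; have ha' : (- a) ^+ q = 0 by rewrite exprNn ha mulr0.
  rewrite -base_change_mul_suml -base_change_mul_sumr -(act_uni hp r_gt0 _ b ha').
  rewrite mxE; apply: eq_bigr => j _; rewrite !mxE -{1}[a]opprK -adj_uni.
  rewrite fadj; last exact: GrT_uni.
  by rewrite mxE mulrC mulr_algl.
have kill i : (0 < i)%N -> eps *m X Q (~~ b) i = 0.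
  move=> i0; case: (ltnP i q) => hi; last by rewrite (X_ge hp r_gt0) // mulmx0.
  have hx := tx_nilp k hq.
  have := eps_parab _ _ (parab_uni b hx).
  rewrite (act_uni hp r_gt0 Q (~~ b) hx) base_change_mul_sumr.
  rewrite (_ : weight_char n _ = tx k q ^+ 0); last first.
    by rewrite weight_charE expr0; case: (b); rewrite !mx2E; case: (n) => ? /=; rewrite expr1n.
  move=> /(functional_expansion1 (functional_coef1 k q i)).
  rewrite (sum_tcoef1_Xn (fun j => eps *m X Q (~~ b) j) hq hi) => ->.
  by rewrite tcoef1Xn ?(q_gt0 r hp) // gtn_eqF // scale0r.
have wteps m : eps *m wt Q m = if m == n then eps else 0.
  apply: kpt_eigen => c c0; apply: (@base_change_inj k k^o).
  rewrite base_changeM -(act_tor_alg hp Q k^o c0).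
  have ht : torus (tor (c%:A : k^o) (c^-1)%:A).
    by apply: torus_tor; rewrite mulr_algl scalerA divff // scale1r.
  rewrite eps_parab; last exact: parab_torus.
  rewrite base_changeZ; congr (_ *: _); rewrite weight_char_tor -chi_exprz.
  by case: (n) => i /=; rewrite exprZn expr1n.
have inj (v : 'cV_(dim Q)) : (forall i, eps *m X Q b i *m v = 0) -> v = 0.
  move=> hv; pose phi A (x : 'M[A]_2) : A := 0.
  have hphi : ind_section (GrT p r) (parab b) n phi.
    by split=> *; rewrite /phi ?rmorph0 ?mulr0.
  have [c [_ cu]] := f_basis phi hphi.
  have c0 : c = 0.
    by apply: cu => A x _; rewrite big1 // => j _; rewrite mxE scale0r.
  rewrite -[v]trmxK -[RHS]trmx0 -c0; congr (_^T); apply/esym/cu => A x hx.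
  have [u [t [t' [h1 h2 h3 hxE]]]] := GrT_factor hp b hx.
  pose h := tor t t' *m uni (~~ b) (off (~~ b) x * u).
  have hh : parab b h.
    by apply: parabM; [apply/parab_torus/torus_tor | apply: parab_uni].
  have -> : \sum_j v^T 0 j *: f j A x =
     weight_char (- n) h * \sum_j v j 0 *: f j A (uni b (off b x * u)).
    rewrite mulr_sumr; apply: eq_bigr => j _; rewrite mxE -scalerAr.
    congr (_ *: _); rewrite {1}hxE.
    exact: ((f_ind j).2 _ _ _ (GrT_uni hp b h2) hh).
  rewrite eps_uni // big1 ?mxE ?mulr0 // => i _.
  by rewrite hv base_change0 scaler0.
have [c [cE _]] := f_basis _ (top_section_ind b n).
pose y := (-1) ^+ q.-1 *: c^T.
exists eps, y; split=> // i.
case: (ltnP i q) => hi; last first.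
  rewrite (X_ge hp r_gt0) // mulmx0 mul0mx gtn_eqF ?scalemx1 ?scale0r ?raddf0 //.
  by rewrite (leq_trans _ hi) // prednK ?(q_gt0 r hp).
have hx := tx_nilp k hq.
have top_eq A (x : A) : x ^+ q = 0 ->
  \sum_(i < q) x ^+ i *: base_change A (eps *m X Q b i *m c^T) =
  ((-1) ^+ q.-1 *: x ^+ q.-1) *: base_change A 1%:M.
  move=> ha; have ha' : (- x) ^+ q = 0 by rewrite exprNn ha mulr0.
  have := eps_uni _ _ c^T ha'; rewrite opprK => e.
  rewrite [LHS]mx11_scalar -{}e base_change1 -scalemx1; congr (_ *: _).
  have := cE A (uni b (- x)) (GrT_uni hp b ha').
  rewrite (eq_bigr (fun j => c^T j 0 *: f j A (uni b (- x)))); last first.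
    by move=> j _; rewrite mxE.
  move=> <-; rewrite /top_section weight_charE.
  have -> : off b (uni b (- x)) = - x by case: (b); rewrite /off /uni /= mx2E.
  rewrite (_ : chi _ _ _ = 1); last first.
    by case: (b); rewrite /uni !mx2E; case: (- n + _) => l; rewrite /chi expr1n.
  by rewrite mulr1 [LHS]exprNn sign_scale.
have := top_eq _ _ hx.
move=> /(functional_expansion1 (functional_coef1 k q i)).
rewrite (sum_tcoef1_Xn (fun j => eps *m X Q b j *m c^T) hq hi) => e.
rewrite /y -scalemxAr e tcoef1Z scalerA mulrA -expr2 sqrr_sign mul1r.
by rewrite tcoef1Xn ?prednK ?(q_gt0 r hp) // scalemx1.
Qed.
End Induced.

(** * Modules filtered by Delta_r(n) *)

Section LinAlg.
Variable k : fieldType.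

Lemma cv_ext m n (A B : 'M[k]_(m, n)) : (forall v : 'cV_n, A *m v = B *m v) -> A = B.
Proof.
move=> h; apply: trmx_inj; apply/row_matrixP => i; rewrite !rowE.
by have := congr1 trmx (h (delta_mx 0 i)^T); rewrite !trmx_mul trmxK.
Qed.

Lemma cv_inj_left_inverse m n (i : 'M[k]_(m, n)) :
  (forall u : 'cV_n, i *m u = 0 -> u = 0) -> exists i', i' *m i = 1%:M.
Proof.
move=> h; have hf : row_free i^T.
  apply: inj_row_free => v hv; apply: trmx_inj; rewrite trmx0; apply: h.
  by apply: trmx_inj; rewrite trmx_mul trmxK hv trmx0.
exists (pinvmx i^T)^T; apply: trmx_inj.
by rewrite trmx_mul trmxK trmx1 mulmxVp.
Qed.

Lemma cv_surj_section m n (q : 'M[k]_(m, n)) :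
  (forall w : 'cV_m, exists v, w = q *m v) -> exists s, q *m s = 1%:M.
Proof.
move=> h; have hf : row_free q.
  apply: inj_row_free => v hv; apply: trmx_inj; rewrite trmx0.
  apply: trmx_inj; rewrite trmxK trmx0; apply: cv_ext => w.
  by have [x ->] := h w; rewrite mulmxA hv !mul0mx.
by exists (pinvmx q); rewrite mulmxVp.
Qed.
End LinAlg.

Section Filtrations.
Variables (k : closedFieldType) (p r : nat).
Hypotheses (hp : p \in [pchar k]) (r_gt0 : (0 < r)%N).
Local Notation q := (p ^ r)%N.
Local Notation GM := (module (GrT (k := k) p r)).
Implicit Types (A B : comAlgType k) (L M N Q : GM).
Local Notation X := (root_op (k := k) (p := p) (r := r)).
Local Notation wt := (wt_proj hp).

(** [i'] is a retraction of the inclusion [i], [s] a section of the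
    projection [pi]. *)
Lemma short_exactP M' M Q : short_exact M' M Q ->
  exists (i : 'M[k]_(dim M, dim M')) (pi : 'M[k]_(dim Q, dim M)) i' s,
  [/\ is_hom i /\ is_hom pi, i' *m i = 1%:M, pi *m s = 1%:M, pi *m i = 0 &
     forall n (h : 'M_(dim M, n)), pi *m h = 0 -> h = i *m (i' *m h)].
Proof.
move=> [i [pi [hi hpi inj ex surj]]].
have [i' hi'] := cv_inj_left_inverse inj; have [s hs] := cv_surj_section surj.
exists i, pi, i', s; split=> //.
  by apply: cv_ext => v; rewrite mul0mx -mulmxA; apply/ex; exists v.
move=> n h ph; apply: cv_ext => v.
have /ex [u hu] : pi *m (h *m v) = 0 by rewrite mulmxA ph mul0mx.
by rewrite -!mulmxA hu [i' *m _]mulmxA hi' mul1mx.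
Qed.

(** In characteristic [p], the binomial coefficients of [q - 1] are signs, because
    those of [q] vanish. *)
Lemma binomial_q j : (j < q)%N -> ('C(q.-1, j)%:R : k) != 0.
Proof.
have q0 := q_gt0 r hp.
have hbin l : (0 < l < q)%N -> ('C(q, l)%:R : k) = 0.
  move=> /andP[l0 lq].
  have e : ('X + 1 : {poly k}) ^+ q = 'X ^+ q + 1.
    rewrite exprDn_pchar ?expr1n //.
    by rewrite pnatX pnatE ?(pcharf_prime hp) // (pchar_lalg {poly k}) hp.
  have := congr1 (fun f : {poly k} => f`_l) e.
  rewrite coefD coefXn coef1 (ltn_eqF lq) (gtn_eqF l0) /= addr0 => e2.
  apply: etrans e2; rewrite addrC exprDn coef_sum.
  have lq' : (l < q.+1)%N by rewrite ltnW.
  rewrite (bigD1 (Ordinal lq')) //= expr1n mul1r coefMn coefXn eqxx big1 ?addr0 //.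
  move=> m hm; rewrite expr1n mul1r coefMn coefXn eq_sym.
  by rewrite (negbTE (hm : (m != l :> nat))) mul0rn.
have hsign : forall l, (l < q)%N -> ('C(q.-1, l)%:R : k) = (-1) ^+ l.
  elim=> [|l IH] hl; first by rewrite bin0.
  have := hbin l.+1 hl; rewrite -{1}(prednK q0) binS natrD IH ?(ltnW hl) // exprS mulN1r.
  by move/eqP; rewrite addr_eq0 => /eqP.
by move=> hj; rewrite hsign // signr_eq0.
Qed.

(** A functional killed by the negative root vectors factors through the top
    power of the negative root vector; this holds for modules that are free
    over the distribution algebra of the lower unipotent group. *)
Definition top_div M := forall phi : 'rV[k]_(dim M),
  (forall j, (0 < j)%N -> phi *m X M false j = 0) ->
  exists psi, phi = psi *m X M false q.-1.

Lemma shift_top (n : int) : n - 2 * (p%:Z ^+ r - 1) = n + shift false q.-1.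
Proof.
rewrite /shift; congr (_ - _); rewrite PoszM -subn1 -subzn ?(q_gt0 r hp) //.
by rewrite -!natz natrX.
Qed.

(** As a module over the F_j, Delta_r(n) is free on the vector [y] of
    [Ind_functional]: the pairing of the F_i and F_j through [eps] is
    antidiagonal, with entries binomial coefficients of [q - 1], which are units. *)
Lemma Delta_top n Q : is_Delta n Q ->
  top_div Q /\ X Q false q.-1 *m wt Q n != 0.
Proof.
rewrite /is_Delta shift_top => hI.
have [eps [y [e1 e2 e3 e4]]] := @Ind_functional _ _ _ hp r_gt0 false _ _ hI.
have q0 := q_gt0 r hp.
have XX i j : eps *m X Q false i *m (X Q false j *m y) =
    ('C(i + j, j)%:R * (i + j == q.-1)%N%:R)%:M.
  rewrite mulmxA -[_ *m X Q false j]mulmxA (X_mul hp r_gt0).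
  by rewrite -scalemxAr -scalemxAl e4 scale_scalar_mx.
have span (phi : 'rV[k]_(dim Q)) : (forall j, phi *m X Q false j *m y = 0) -> phi = 0.
  move=> h; apply: cv_ext => v; rewrite mul0mx.
  pose d i := (eps *m X Q false i *m v) 0 0.
  pose c j := d (q.-1 - j)%N / 'C(q.-1, j)%:R.
  have -> : v = \sum_(j < q) c j *: (X Q false j *m y).
    apply/eqP; rewrite -subr_eq0; apply/eqP; apply: e3 => i.
    case: (ltnP i q) => hi; last by rewrite (X_ge hp r_gt0) // mulmx0 mul0mx.
    rewrite mulmxBr mulmx_sumr.
    have hj : (q.-1 - i < q)%N by rewrite (leq_ltn_trans (leq_subr _ _)) ?prednK.
    have ij : (i + (q.-1 - i) = q.-1)%N by rewrite subnKC // -ltnS prednK.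
    rewrite (bigD1 (Ordinal hj)) //= big1 ?addr0; last first.
      move=> j hjj; rewrite -scalemxAr XX (_ : (i + j == q.-1)%N = false).
        by rewrite mulr0 raddf0 scaler0.
      apply: contraNF hjj => /eqP e; apply/eqP/val_inj => /=.
      by rewrite -e addKn.
    rewrite -scalemxAr XX ij eqxx mulr1 scale_scalar_mx /c subKn; last by rewrite -ltnS prednK.
    by rewrite divfK ?binomial_q // -mx11_scalar subrr.
  rewrite mulmx_sumr big1 // => j _.
  by rewrite -scalemxAr mulmxA h scaler0.
split.
  move=> phi hphi; pose c := (phi *m y) 0 0.
  exists (c *: eps); apply/eqP; rewrite -subr_eq0; apply/eqP; apply: span => j.
  rewrite mulmxBl -scalemxAl mulmxBl -!scalemxAl -[eps *m _ *m _ *m y]mulmxA XX.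
  case: j => [|j].
    rewrite (X0 hp r_gt0) mulmx1 addn0 bin0 eqxx mulr1 scale_scalar_mx mulr1.
    by rewrite -mx11_scalar subrr.
  rewrite hphi // mul0mx (_ : (q.-1 + j.+1 == q.-1)%N = false).
    by rewrite mulr0 raddf0 scaler0 subr0.
  by rewrite -[X in _ == X]addn0 eqn_add2l.
apply/eqP => h0; have := e4 q.-1.
have -> : eps *m X Q false q.-1 = eps *m (X Q false q.-1 *m wt Q n).
  rewrite -{1}[n](addrK (shift false q.-1)) -wt_X // mulmxA.
  by rewrite e2 eqxx.
rewrite h0 mulmx0 mul0mx eqxx => /matrixP /(_ 0 0); rewrite !mxE eqxx => /eqP.
by rewrite eq_sym oner_eq0.
Qed.

(** The property passes to extensions: correct [phi] by a multiple of F_(q-1) to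
    make it vanish on the submodule. *)
Lemma top_div_ext M' M Q : short_exact M' M Q -> top_div M' -> top_div Q -> top_div M.
Proof.
move=> /short_exactP[i [pi [i' [s [[hi hpi] ii ps pii ex]]]]] tM' tQ phi hphi.
have [j j0|psi' hpsi'] := tM' (phi *m i).
  by rewrite -mulmxA (hom_X hp r_gt0 _ _ hi) mulmxA hphi // mul0mx.
pose psi1 := psi' *m i'.
pose d := phi - psi1 *m X M false q.-1.
have di : d *m i = 0.
  by rewrite mulmxBl hpsi' -[psi1 *m _ *m i]mulmxA -(hom_X hp r_gt0 _ _ hi)
    mulmxA -[psi1 *m i]mulmxA ii mulmx1 subrr.
have dpi : d = d *m s *m pi.
  apply/eqP; rewrite -subr_eq0 -mulmxA -{1}[d]mulmx1 -mulmxBr; apply/eqP.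
  rewrite [_ - _]ex ?mulmxA ?di ?mul0mx //.
  by rewrite mulmxBr mulmx1 mulmxA ps mul1mx subrr.
have dX j : (0 < j)%N -> d *m X M false j = 0.
  move=> j0; rewrite mulmxBl hphi // -mulmxA (X_mul hp r_gt0) (X_ge hp r_gt0).
    by rewrite scaler0 mulmx0 subrr.
  by rewrite -{1}(prednK (q_gt0 r hp)) -addn1 leq_add2l.
have [j j0|psi2 hpsi2] := tQ (d *m s).
  have e := dX j j0; rewrite dpi -mulmxA (hom_X hp r_gt0 _ _ hpi) mulmxA in e.
  by have := congr1 (mulmx^~ s) e; rewrite /= mul0mx -mulmxA ps mulmx1.
exists (psi1 + psi2 *m pi).
rewrite mulmxDl -mulmxA (hom_X hp r_gt0 _ _ hpi) mulmxA -hpsi2 -dpi.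
by rewrite addrC subrK.
Qed.

(** The operator F_(q-1) on the weight space of weight [n]; its rank bounds the
    number of factors Delta_r(n). *)
Definition topw M n := X M false q.-1 *m wt M n.

Lemma topw_hom M N (f : 'M_(dim N, dim M)) n : is_hom f -> f *m topw M n = topw N n *m f.
Proof.
by move=> hf; rewrite mulmxA (hom_X hp r_gt0 _ _ hf) -!mulmxA (hom_wt hp _ hf).
Qed.

Lemma topw_rank M' M Q n : short_exact M' M Q ->
  (\rank (topw M' n) + \rank (topw Q n) <= \rank (topw M n))%N.
Proof.
move=> /short_exactP[i [pi [i' [s [[hi hpi] ii ps pii ex]]]]].
rewrite -[\rank (topw M n)]mxrank_tr -(mxrank_mul_ker (topw M n)^T pi^T) addnC.
apply: leq_add.
  rewrite -trmx_mul topw_hom // mxrank_tr.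
  by rewrite -{1}[topw Q n]mulmx1 -ps mulmxA mxrankM_maxl.
have -> : \rank (topw M' n) = \rank (i *m topw M' n)^T.
  rewrite mxrank_tr; apply/eqP; rewrite eqn_leq mxrankM_maxr andbT.
  by rewrite -{1}[topw M' n]mul1mx -ii -mulmxA mxrankM_maxr.
apply: mxrankS; rewrite sub_capmx; apply/andP; split.
  by rewrite topw_hom // trmx_mul submxMl.
apply/sub_kermxP; rewrite -trmx_mul mulmxA pii mul0mx.
exact: trmx0.
Qed.

Lemma Delta_filtration_top M s : filtration (@is_Delta k p r) M s ->
  top_div M /\ forall n, (count_mem n s <= \rank (topw M n))%N.
Proof.
elim=> [N hN|M' N Q n s' _ [tM' cM'] hQ hex].
  split=> // phi _; exists 0; apply/rowP=> [[j hj]].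
  by exfalso; rewrite hN in hj.
have [tQ nzQ] := Delta_top hQ.
split; first exact: top_div_ext hex tM' tQ.
move=> m; apply: leq_trans (topw_rank m hex); rewrite /= addnC.
apply: leq_add => //; case: eqP => // <-.
by rewrite lt0n mxrank_eq0.
Qed.
End Filtrations.

(** * Modules filtered by nabla_r(n) *)

Section NablaTrace.
Variables (k : closedFieldType) (p r : nat).
Hypotheses (hp : p \in [pchar k]) (r_gt0 : (0 < r)%N).
Local Notation q := (p ^ r)%N.
Local Notation GM := (module (GrT (k := k) p r)).
Implicit Types (A B : comAlgType k) (L M N Q : GM).
Local Notation X := (root_op (k := k) (p := p) (r := r)).
Local Notation wt := (wt_proj hp).
Local Notation trace := (relative_trace (k := k) (p := p) (r := r)).

Lemma adX_homl L M N b n (g : 'M_(dim N, dim M)) (u : 'M_(dim M, dim L)) :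
  is_hom g -> adX b n (g *m u) = g *m adX b n u :> 'M_(dim N, dim L).
Proof.
move=> hg; rewrite /adX mulmx_sumr; apply: eq_bigr => i _.
rewrite mulmx_sumr; apply: eq_bigr => j _.
by rewrite -scalemxAr !mulmxA (hom_X hp r_gt0 _ _ hg).
Qed.

Lemma trace_homl L M N (g : 'M_(dim N, dim M)) (u : 'M_(dim M, dim L)) :
  is_hom g -> trace (g *m u) = g *m trace u :> 'M_(dim N, dim L).
Proof. by move=> hg; rewrite /relative_trace !adX_homl. Qed.

Lemma adXD L M b n (u v : 'M_(dim M, dim L)) :
  adX b n (u + v) = adX b n u + adX b n v :> 'M_(dim M, dim L).
Proof.
rewrite /adX -big_split; apply: eq_bigr => i _.
rewrite -big_split; apply: eq_bigr => j _.
by rewrite /= mulmxDr mulmxDl scalerDr.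
Qed.

Lemma traceD L M (u v : 'M_(dim M, dim L)) :
  trace (u + v) = trace u + trace v :> 'M_(dim M, dim L).
Proof. by rewrite /relative_trace !adXD. Qed.

(** The linear maps that commute with the torus. *)
Definition wt_map L M (u : 'M[k]_(dim M, dim L)) := forall n, wt M n *m u = u *m wt L n.

(** The component of weight zero of a linear map. *)
Definition wt_part L M (u : 'M[k]_(dim M, dim L)) : 'M_(dim M, dim L) :=
  \sum_(n <- wsupp hp M) wt M n *m u *m wt L n.

Lemma wt_part_map L M (u : 'M[k]_(dim M, dim L)) : wt_map (wt_part u).
Proof.
move=> m; rewrite /wt_part mulmx_sumr mulmx_suml; apply: eq_bigr => n _.
rewrite !mulmxA wt_mul -[_ *m wt L n *m _]mulmxA wt_mul.
by rewrite eq_sym; case: eqP => [->|_] //; rewrite !mul0mx mulmx0.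
Qed.

Lemma wt_part_homl L M Q (pi : 'M_(dim Q, dim M)) u (v : 'M[k]_(dim Q, dim L)) :
  is_hom pi -> pi *m u = v -> wt_map v -> pi *m wt_part u = v.
Proof.
move=> hpi puv hv; rewrite /wt_part mulmx_sumr.
transitivity (pi *m (\sum_(n <- wsupp hp M) wt M n) *m u); last first.
  by rewrite wt_sum1 ?wsupp_uniq // mulmx1.
rewrite mulmx_sumr mulmx_suml; apply: eq_bigr => n _.
rewrite !mulmxA (hom_wt hp _ hpi) -!mulmxA [pi *m (u *m _)]mulmxA puv -hv.
by rewrite mulmxA wt_mul eqxx.
Qed.

Lemma hom_sub L M (f g : 'M[k]_(dim M, dim L)) : is_hom f -> is_hom g -> is_hom (f - g).
Proof.
move=> hf hg; apply: (hom_of_ops (hp := hp) r_gt0) => [b i|n].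
  by rewrite mulmxBl mulmxBr !(hom_X hp r_gt0 _ _ hf) (hom_X hp r_gt0 _ _ hg).
by rewrite mulmxBl mulmxBr (hom_wt hp _ hf) (hom_wt hp _ hg).
Qed.

Lemma adX_low L M (eps : 'rV[k]_(dim M)) b (u : 'M_(dim M, dim L)) :
  (forall i, (0 < i)%N -> eps *m X M b i = 0) ->
  eps *m adX b q.-1 u = (-1) ^+ q.-1 *: (eps *m u *m X L b q.-1).
Proof.
move=> he; have q0 := q_gt0 r hp.
have q1 : (q.-1 < q)%N by rewrite prednK.
rewrite /adX mulmx_sumr (bigD1 (Ordinal q0)) //= [X in _ + X]big1 ?addr0; last first.
  move=> i hi; rewrite mulmx_sumr big1 // => j _.
  by rewrite -scalemxAr !mulmxA he ?mul0mx ?scaler0 // lt0n; exact: hi.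
rewrite mulmx_sumr (bigD1 (Ordinal q1)) //= add0n eqxx [X in _ + X]big1 ?addr0; last first.
  move=> j hj; rewrite add0n (negbTE (hj : (j != q.-1 :> nat))) scale0r.
  by rewrite mulmx0.
by rewrite -scalemxAr (X0 hp r_gt0) mul1mx mulmxA.
Qed.

(** A homomorphism [f] from [L] to nabla_r(n) is determined by the functional
    [eps *m f], which factors through F_(q-1) by hypothesis on [L].  This gives a
    map [u] of rank one with values in the lowest weight space, whose trace has
    the same composite with [eps]. *)
Lemma nabla_trace n L Q f : is_nabla n Q -> top_div L -> @is_hom k _ L Q f ->
  exists u, wt_map u /\ f = trace u.
Proof.
move=> hI tL hf; have q0 := q_gt0 r hp.
have q1 : (q.-1 < q)%N by rewrite prednK.
have [eps [y [e1 e2 e3 e4]]] := @Ind_functional _ _ _ hp r_gt0 true _ _ hI.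
rewrite /= in e1.
have [j j0|psi hpsi] := tL (eps *m f).
  by rewrite -mulmxA (hom_X hp r_gt0 _ _ hf) mulmxA e1 // mul0mx.
(* The lowest weight of nabla_r(n). *)
pose m0 := n - shift true q.-1.
pose y0 := wt Q m0 *m y; pose psi0 := psi *m wt L m0.
have e4' i : eps *m X Q true i *m y0 = (i == q.-1)%:R%:M.
  rewrite /y0 mulmxA -[_ *m wt Q m0]mulmxA.
  have -> : m0 = (m0 + shift true i) - shift true i by rewrite addrK.
  rewrite -wt_X // mulmxA e2; case: eqP => h; rewrite ?e4 // !mul0mx.
  case: eqP => [ei|]; last by rewrite raddf0.
  by case: h; rewrite /m0 ei subrK.
pose u := (-1) ^+ q.-1 *: (y0 *m psi0).
have hu : wt_map u.
  move=> l; rewrite /u -scalemxAr -scalemxAl; congr (_ *: _).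
  rewrite /y0 /psi0 !mulmxA wt_mul -[_ *m wt L m0 *m wt L l]mulmxA wt_mul eq_sym.
  by case: eqP => [->|_] //; rewrite mulmx0 !mul0mx.
have epsu i : eps *m X Q true i *m u =
    (-1) ^+ q.-1 *: ((i == q.-1)%:R%:M *m psi0).
  by rewrite /u -scalemxAr mulmxA e4'.
have eu : eps *m adX true q.-1 u = (-1) ^+ q.-1 *: psi0.
  rewrite /adX mulmx_sumr (bigD1 (Ordinal q1)) //= [X in _ + X]big1 ?addr0; last first.
    move=> i hi; rewrite mulmx_sumr big1 // => j _.
    rewrite -scalemxAr !mulmxA epsu (negbTE (hi : (i != q.-1 :> nat))).
    by rewrite raddf0 !(mul0mx, scaler0).
  rewrite mulmx_sumr (bigD1 (Ordinal q0)) //= addn0 eqxx [X in _ + X]big1 ?addr0; last first.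
    move=> j hj; rewrite -[X in (_ == X)%N]addn0 eqn_add2l.
    by rewrite (negbTE (hj : (j != 0 :> nat))) scale0r mulmx0.
  rewrite expr0 scale1r (X0 hp r_gt0) mulmx1 mulmxA epsu eqxx.
  by rewrite mul1mx.
exists u; split=> //.
pose h := f - trace u.
have hh : is_hom h by apply: hom_sub => //; apply: (trace_hom r_gt0 hu).
have eh : eps *m h = 0.
  rewrite mulmxBr /relative_trace adX_low // eu -scalemxAl scalerA -expr2 sqrr_sign scale1r.
  rewrite /psi0 -mulmxA wt_X // mulmxA -hpsi -mulmxA (hom_wt hp _ hf) mulmxA e2.
  by rewrite /m0 /shift opprK subrK eqxx subrr.
apply/eqP; rewrite -subr_eq0; apply/eqP; apply: cv_ext => v.
rewrite mul0mx; apply: e3 => i.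
by rewrite -/h mulmxA -[eps *m _ *m h]mulmxA -(hom_X hp r_gt0 _ _ hh) mulmxA eh !mul0mx.
Qed.

(** Induction on the filtration of [M]: lift a map whose trace is the composite of
    [f] with the projection onto the top factor, and subtract its trace. *)
Lemma nabla_filtration_trace L M s : top_div L -> filtration (@is_nabla k p r) M s ->
  forall f, @is_hom k _ L M f -> exists u, wt_map u /\ f = trace u.
Proof.
move=> tL; elim=> [N hN f hf|M' N Q n s' _ IH hQ hex f hf].
  have z m (g h : 'M[k]_(dim N, m)) : g = h.
    by apply/matrixP=> [[j hj]]; exfalso; rewrite hN in hj.
  by exists 0; split=> [m|]; apply: z.
have [i [pi [i' [sg [[hi hpi] ii ps pii ex]]]]] := short_exactP hex.
have hpf : is_hom (pi *m f).
  apply: (hom_of_ops (hp := hp) r_gt0) => [b j|m].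
    by rewrite -mulmxA (hom_X hp r_gt0 _ _ hf) !mulmxA (hom_X hp r_gt0 _ _ hpi).
  by rewrite -mulmxA (hom_wt hp _ hf) !mulmxA (hom_wt hp _ hpi).
have [v [hv vE]] := nabla_trace hQ tL hpf.
pose u1 := wt_part (sg *m v).
have hu1 : wt_map u1 := wt_part_map _.
have pu1 : pi *m u1 = v.
  by apply: wt_part_homl => //; rewrite mulmxA ps mul1mx.
pose h := f - trace u1.
have hh : is_hom h by apply: hom_sub => //; apply: (trace_hom r_gt0 hu1).
have ph : pi *m h = 0 by rewrite mulmxBr -trace_homl // pu1 vE subrr.
have [g hE] : exists g, h = i *m g by exists (i' *m h); apply: ex.
have cancel m (a b : 'M[k]_(dim M', m)) : i *m a = i *m b -> a = b.
  by move=> /(congr1 (mulmx i')); rewrite !mulmxA ii !mul1mx.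
have hg : is_hom g.
  apply: (hom_of_ops (hp := hp) r_gt0) => [b j|m]; apply: cancel; rewrite !mulmxA.
    by rewrite -hE (hom_X hp r_gt0 _ _ hh) hE mulmxA (hom_X hp r_gt0 _ _ hi).
  by rewrite -hE (hom_wt hp _ hh) hE mulmxA (hom_wt hp _ hi).
have [u2 [hu2 u2E]] := IH g hg.
exists (u1 + i *m u2); split.
  move=> m; rewrite mulmxDl mulmxDr hu1; congr (_ + _).
  by rewrite mulmxA -(hom_wt hp _ hi) -!mulmxA hu2.
by rewrite traceD trace_homl // -u2E -hE addrC subrK.
Qed.
End NablaTrace.

(** * Fitting idempotents *)

Section Fitting.
Variable k : fieldType.

Lemma horner_mx_eigen n (e : 'M[k]_n.+1) a m (C : 'M_(n.+1, m)) (f : {poly k}) :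
  e *m C = a *: C -> horner_mx e f *m C = f.[a] *: C.
Proof.
move=> h; elim/poly_ind: f => [|f c IH].
  by rewrite rmorph0 mul0mx horner0 scale0r.
rewrite rmorphD rmorphM /= horner_mx_X horner_mx_C mulmxDl -mulmxA h.
by rewrite -scalemxAr IH mul_scalar_mx !hornerE scalerDl scalerA mulrC.
Qed.

(** The idempotent of the Fitting decomposition of [e], whose image is the image of
    the large powers of [e] and whose kernel is theirs.  It is a polynomial in
    [e]. *)
Lemma fitting_idempotent n (e : 'M[k]_n) : exists P : 'M_n,
  [/\ P *m P = P, forall Z, Z *m e = e *m Z -> Z *m P = P *m Z,
      forall m (C : 'M_(n, m)), e *m C = C -> P *m C = C &
      forall m (C : 'M_(n, m)), e *m C = 0 -> P *m C = 0].
Proof.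
case: n e => [|n] e.
  exists 0; split=> [|Z _|m C _|m C _]; first by rewrite mulmx0.
  - by rewrite mulmx0 mul0mx.
  - by rewrite [C]flatmx0 mulmx0.
  by rewrite mul0mx.
have [m [g hg0 hg]] := multiplicity_XsubC (char_poly e) 0.
rewrite monic_neq0 ?char_poly_monic //= in hg0; rewrite subr0 in hg.
pose xm : {poly k} := 'X ^+ m.+1.
have ann : horner_mx e (g * xm) = 0.
  rewrite /xm exprSr mulrA -hg rmorphM /= Cayley_Hamilton.
  exact: mul0mx.
have cop : coprimep xm g.
  by apply: coprimep_expl; rewrite coprimep_sym -['X]subr0 coprimep_XsubC.
have [[u v] /= huv] := Bezout_coprimepP _ _ cop.
have [c c0 hc] : exists2 c, c != 0 & u * xm + v * g = c%:P.
  move: huv; rewrite -size_poly_eq1 => /eqP /eqP /size_poly1P [c c0 ->].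
  by exists c.
(* The Bezout relation makes [f] an idempotent modulo [g * xm]. *)
pose f := c^-1 *: (u * xm).
have hf : f + c^-1 *: (v * g) = 1.
  by rewrite -scalerDr hc -mul_polyC -polyCM mulVf.
have hf' : f * f = f - (c^-1 *: u * (c^-1 *: v)) * (g * xm).
  have e1 : 1 - f = c^-1 *: (v * g) by rewrite -hf addrC addKr.
  have -> : f * f = f - f * (1 - f) by ring.
  by rewrite e1 /f -!mul_polyC; ring.
exists (horner_mx e f); split.
- rewrite [LHS](_ : _ = horner_mx e (f * f)); last by rewrite rmorphM.
  by rewrite hf' rmorphB [X in _ - X]rmorphM /= ann mulr0 subr0.
- by move=> Z hZ; apply: comm_mx_horner.
- move=> l C hC; have hC1 : e *m C = 1 *: C by rewrite scale1r.
  have := horner_mx_eigen (g * xm) hC1; rewrite ann mul0mx => h0.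
  have e1 := congr1 (horner^~ 1) hf; rewrite /= hornerD hornerC in e1.
  rewrite (horner_mx_eigen _ hC1).
  have e4 : (f.[1] + (c^-1 *: (v * g)).[1]) *: C = C by rewrite e1 scale1r.
  have g1 : g.[1] *: C = 0.
    by rewrite [RHS]h0 hornerM hornerXn expr1n mulr1.
  have e3 : (c^-1 *: (v * g)).[1] = c^-1 * v.[1] * g.[1].
    by rewrite hornerZ hornerM mulrA.
  by rewrite -[RHS]e4 scalerDl e3 -scalerA g1 scaler0 addr0.
move=> l C hC; have hC0 : e *m C = 0 *: C by rewrite scale0r.
by rewrite (horner_mx_eigen _ hC0) /f hornerZ hornerM hornerXn expr0n !mulr0 scale0r.
Qed.

Lemma mulmx_idem_cancel m n (C pr : 'M[k]_(n, m)) (R pc : 'M_(m, n)) :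
  pc *m C = 1%:M -> R *m pr = 1%:M -> C *m R *m (C *m R) = C *m R -> R *m C = 1%:M.
Proof.
move=> h1 h2 /(congr1 (mulmx pc)) /(congr1 (mulmx^~ pr)) /=.
by rewrite !mulmxA h1 !mul1mx -mulmxA h2 mulmx1.
Qed.

(** An idempotent matrix is the composite of a projection and an inclusion. *)
Lemma idempotent_split n (P : 'M[k]_n) : P *m P = P ->
  exists m (C : 'M_(n, m)) (R : 'M_(m, n)), C *m R = P /\ R *m C = 1%:M.
Proof.
move=> hP; exists (\rank P), (col_base P), (row_base P); rewrite mulmx_base; split=> //.
apply: (mulmx_idem_cancel (mulVpmx (col_base_full P)) (mulmxVp (row_base_free P))).
by rewrite mulmx_base.
Qed.
End Fitting.

(** * Simple socle and multiplicity one *)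

Section Uniform.
Variables (k : closedFieldType) (p r : nat).
Hypotheses (hp : p \in [pchar k]) (r_gt0 : (0 < r)%N).
Local Notation q := (p ^ r)%N.
Local Notation GM := (module (GrT (k := k) p r)).
Implicit Types (A B : comAlgType k) (L M N Q T : GM).
Local Notation X := (root_op (k := k) (p := p) (r := r)).
Local Notation wt := (wt_proj hp).
Local Notation trace := (relative_trace (k := k) (p := p) (r := r)).

Section Summand.
Variables (T : GM) (m : nat) (C : 'M[k]_(dim T, m)) (R : 'M[k]_(m, dim T)).
Hypotheses (RC : R *m C = 1%:M) (hom_CR : @is_hom k _ T T (C *m R)).

(** The action of [g] on the image of [C *m R], in the coordinates of [C]. *)
Definition summand_act A (g : 'M[A]_2) : 'M[A]_m :=
  base_change A R *m act T g *m base_change A C.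

Lemma summand_natural A B (phi : {lrmorphism A -> B}) (g : 'M[A]_2) :
  GrT p r g -> summand_act (map_mx phi g) = map_mx phi (summand_act g).
Proof.
by move=> hg; rewrite /summand_act !map_mxM !map_base_change act_natural.
Qed.

Lemma summand_act1 A : @summand_act A 1%:M = 1%:M.
Proof. by rewrite /summand_act act1 mulmx1 -base_changeM RC base_change1. Qed.

Lemma summand_incl A (g : 'M[A]_2) : GrT p r g ->
  base_change A C *m summand_act g = act T g *m base_change A C.
Proof.
move=> hg; rewrite /summand_act !mulmxA -base_changeM hom_CR //.
by rewrite -mulmxA -base_changeM -mulmxA RC mulmx1.
Qed.

Lemma summand_actM A (g h : 'M[A]_2) : GrT p r g -> GrT p r h ->
  summand_act (g *m h) = summand_act g *m summand_act h.
Proof.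
move=> hg hh; have e := summand_incl hh.
have -> : summand_act g *m summand_act h =
    base_change A R *m act T g *m (base_change A C *m summand_act h).
  exact: (esym (mulmxA _ _ _)).
by rewrite e /summand_act actM // !mulmxA.
Qed.

(** The direct summand cut out by the idempotent endomorphism [C *m R]. *)
Definition summand : GM := Module summand_natural summand_act1 summand_actM.
End Summand.

Lemma indecomposable_idempotent T (P : 'M[k]_(dim T)) : indecomposable T ->
  is_hom P -> P *m P = P -> P = 0 \/ P = 1%:M.
Proof.
move=> [_ hT] hP PP.
(* [P] and [1 - P] cut out complementary summands. *)
pose P' := 1%:M - P.
have PP' : P' *m P' = P'.
  by rewrite /P' mulmxBr mulmx1 mulmxBl mul1mx PP subrr subr0.
have hP' : @is_hom k _ T T P'.
  apply: (hom_sub hp r_gt0) => //.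
  by move=> A g _; rewrite base_change1 mul1mx mulmx1.
have [m1 [C1 [R1 [e1 f1]]]] := idempotent_split PP.
have [m2 [C2 [R2 [e2 f2]]]] := idempotent_split PP'.
have h1 : @is_hom k _ T T (C1 *m R1) by rewrite e1.
have h2 : @is_hom k _ T T (C2 *m R2) by rewrite e2.
have R1C2 : R1 *m C2 = 0.
  have z : P *m P' = 0 by rewrite /P' mulmxBr mulmx1 PP subrr.
  rewrite -[R1]mul1mx -f1 -[C2]mulmx1 -f2 !mulmxA -[R1 *m C1 *m R1]mulmxA e1.
  by rewrite -[_ *m C2 *m R2]mulmxA e2 -[R1 *m P *m P']mulmxA z mulmx0 mul0mx.
have R2C1 : R2 *m C1 = 0.
  have z : P' *m P = 0 by rewrite /P' mulmxBl mul1mx PP subrr.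
  rewrite -[R2]mul1mx -f2 -[C1]mulmx1 -f1 !mulmxA -[R2 *m C2 *m R2]mulmxA e2.
  by rewrite -[_ *m C1 *m R1]mulmxA e1 -[R2 *m P' *m P]mulmxA z mulmx0 mul0mx.
have ds : is_direct_sum (summand f1 h1) (summand f2 h2) T.
  exists C1, C2; split=> [A g hg|A g hg|v] /=.
  - exact: summand_incl.
  - exact: summand_incl.
  exists (R1 *m v, R2 *m v); split=> /= [|[u1 u2] /= ->].
    by rewrite !mulmxA e1 e2 -mulmxDl /P' addrC subrK mul1mx.
  by rewrite !mulmxDr !mulmxA f1 f2 R1C2 R2C1 !mul1mx !mul0mx addr0 add0r.
have := hT _ _ ds => /= -[m0|m0].
  left; rewrite -e1; move: (C1) (R1); rewrite m0 => C R.
  by rewrite [R]flatmx0 mulmx0.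
right; apply/esym/eqP; rewrite -subr_eq0 -/P' -e2; apply/eqP.
by move: (C2) (R2); rewrite m0 => C R; rewrite [R]flatmx0 mulmx0.
Qed.

(** The subspaces of [T] stable under all operators, that is the submodules; a
    subspace is the row space of a matrix of transposed vectors. *)
Definition stable T m (W : 'M[k]_(m, dim T)) :=
  (forall b i, (W *m (X T b i)^T <= W)%MS) /\ (forall n, (W *m (wt T n)^T <= W)%MS).

Lemma stable_cols T m (W : 'M[k]_(m, dim T)) : stable W ->
  (forall b i, exists D, X T b i *m W^T = W^T *m D) /\
  (forall n, exists D, wt T n *m W^T = W^T *m D).
Proof.
move=> [h1 h2]; split=> [b i|n].
  have /submxP[D e] := h1 b i; exists D^T.
  by apply: trmx_inj; rewrite trmx_mul trmxK e trmx_mul !trmxK.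
have /submxP[D e] := h2 n; exists D^T.
by apply: trmx_inj; rewrite trmx_mul trmxK e trmx_mul !trmxK.
Qed.

Lemma stable_cap T m1 m2 (W1 : 'M[k]_(m1, dim T)) (W2 : 'M_(m2, dim T)) :
  stable W1 -> stable W2 -> stable (W1 :&: W2)%MS.
Proof.
move=> [a1 b1] [a2 b2]; split=> *; rewrite sub_capmx.
  by rewrite (submx_trans (submxMr _ (capmxSl _ _)) (a1 _ _))
    (submx_trans (submxMr _ (capmxSr _ _)) (a2 _ _)).
by rewrite (submx_trans (submxMr _ (capmxSl _ _)) (b1 _))
    (submx_trans (submxMr _ (capmxSr _ _)) (b2 _)).
Qed.

Lemma adX_agree T b n m (C : 'M[k]_(dim T, m)) (u u' : 'M_(dim T)) :
  (forall b i, exists D, X T b i *m C = C *m D) -> u *m C = u' *m C ->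
  @adX k p r T T b n u *m C = @adX k p r T T b n u' *m C.
Proof.
move=> hC uC; rewrite /adX !mulmx_suml; apply: eq_bigr => i _.
rewrite !mulmx_suml; apply: eq_bigr => j _; rewrite -!scalemxAl.
congr (_ *: _); have [D e] := hC b j; rewrite -!mulmxA e.
by rewrite [u *m _]mulmxA uC !mulmxA.
Qed.

Lemma trace_agree T m (C : 'M[k]_(dim T, m)) (u u' : 'M_(dim T)) :
  (forall b i, exists D, X T b i *m C = C *m D) -> u *m C = u' *m C ->
  @trace T T u *m C = @trace T T u' *m C.
Proof. by move=> hC uC; do 2 apply: adX_agree => //. Qed.

Lemma trace0 T : @trace T T 0 = 0.
Proof.
have z b n : @adX k p r T T b n 0 = 0.
  by rewrite /adX big1 // => i _; rewrite big1 // => j _; rewrite mulmx0 mul0mx scaler0.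
by rewrite /relative_trace !z.
Qed.

(** In an indecomposable module whose identity is a trace, two nonzero
    submodules intersect: otherwise the trace of [u *m f1], for a projection [f1]
    onto one of them along the other that commutes with the torus, is an
    endomorphism that is neither nilpotent nor invertible. *)
Lemma stable_disjoint T (u : 'M[k]_(dim T)) m1 m2
    (W1 : 'M[k]_(m1, dim T)) (W2 : 'M_(m2, dim T)) :
  indecomposable T -> @wt_map k p r hp T T u -> @trace T T u = 1%:M ->
  stable W1 -> stable W2 -> (W1 :&: W2)%MS = 0 -> W1 = 0 \/ W2 = 0.
Proof.
move=> hT hu tu s1 s2 hW.
have [c1 d1] := stable_cols s1; have [c2 d2] := stable_cols s2.
have hW' : (<<W1>> :&: <<W2>>)%MS = 0.
  apply/eqP; rewrite -submx0 -hW sub_capmx.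
  rewrite (submx_trans (capmxSl _ _)) ?genmxE //.
  by rewrite (submx_trans (capmxSr _ _)) ?genmxE.
pose f0 := (proj_mx <<W1>>%MS <<W2>>%MS)^T.
have f01 : f0 *m W1^T = W1^T.
  by rewrite /f0 -trmx_mul proj_mx_id // genmxE.
have f02 : f0 *m W2^T = 0.
  by rewrite /f0 -trmx_mul proj_mx_0 ?trmx0 // genmxE.
pose f1 : 'M_(dim T) := @wt_part k p r hp T T f0.
have hf1 : @wt_map k p r hp T T f1 := @wt_part_map k p r hp T T f0.
have f11 : f1 *m W1^T = W1^T.
  rewrite /f1 /wt_part mulmx_suml -[RHS]mul1mx.
  rewrite -(wt_sum1 (hp := hp) (wsupp_uniq hp T) (fun _ h => h)) mulmx_suml.
  apply: eq_bigr => n _; have [D e] := d1 n.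
  by rewrite -!mulmxA e [f0 *m _]mulmxA f01 -e mulmxA wt_mul eqxx.
have f12 : f1 *m W2^T = 0.
  rewrite /f1 /wt_part mulmx_suml big1 // => n _; have [D e] := d2 n.
  by rewrite -!mulmxA e [f0 *m _]mulmxA f02 mul0mx mulmx0.
pose e : 'M_(dim T) := @trace T T (u *m f1).
have he : @is_hom k _ T T e.
  apply: (trace_hom r_gt0 (hp := hp)) => n.
  by rewrite mulmxA hu -!mulmxA hf1.
have e1 : e *m W1^T = W1^T.
  rewrite /e (trace_agree (u' := u) c1) ?tu ?mul1mx //.
  by rewrite -mulmxA f11.
have e2 : e *m W2^T = 0.
  rewrite /e (trace_agree (u' := 0) c2) ?trace0 ?mul0mx //.
  by rewrite -mulmxA f12 mulmx0.
have [P [PP Pcomm P1 P2]] := fitting_idempotent e.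
have hP : @is_hom k _ T T P.
  apply: (hom_of_ops (hp := hp) r_gt0) => [b i|n]; apply/esym/Pcomm.
    by rewrite (hom_X hp r_gt0 _ _ he).
  by rewrite (hom_wt hp _ he).
case: (indecomposable_idempotent hT hP PP) => PE.
  left; apply: trmx_inj; rewrite trmx0 -(P1 _ _ e1) PE; exact: mul0mx.
right; apply: trmx_inj; rewrite trmx0 -(P2 _ _ e2) PE; exact/esym/mul1mx.
Qed.

(** Every nonzero submodule contains a minimal one. *)
Lemma minimal_stable T (d : nat) : forall m (W : 'M[k]_(m, dim T)), stable W -> W != 0 ->
  (\rank W <= d)%N -> exists l (L : 'M[k]_(l, dim T)), [/\ stable L, L != 0 &
   forall m' (W' : 'M[k]_(m', dim T)), stable W' -> W' != 0 -> (W' <= L)%MS -> (L <= W')%MS].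
Proof.
elim: d => [|d IH] m W sW W0 rW.
  by move: W0; rewrite -mxrank_eq0 -leqn0 rW.
case: (classic (exists m' (W' : 'M[k]_(m', dim T)), [/\ stable W', W' != 0 & (W' < W)%MS])).
  move=> [m' [W' [sW' W'0 lW]]]; apply: (IH _ W') => //.
  by rewrite -ltnS (leq_trans (rank_ltmx lW)).
move=> hn; exists m, W; split=> // m' W' sW' W'0 le.
apply: contraT => nle; case: hn; exists m', W'; split=> //.
by rewrite ltmxE le.
Qed.

(** In an indecomposable module whose identity is a trace, a minimal nonzero
    submodule lies in every nonzero submodule. *)
Lemma simple_socle T (u : 'M[k]_(dim T)) :
  indecomposable T -> @wt_map k p r hp T T u -> @trace T T u = 1%:M ->
  exists l (L : 'M[k]_(l, dim T)), [/\ stable L, L != 0 &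
   forall m' (W' : 'M[k]_(m', dim T)), stable W' -> W' != 0 -> (L <= W')%MS].
Proof.
move=> hT hu tu.
have s1 : stable (1%:M : 'M[k]_(dim T)) by split=> *; apply: submx1.
have n1 : (1%:M : 'M[k]_(dim T)) != 0.
  rewrite -mxrank_eq0 mxrank1; apply/eqP; exact: hT.1.
have [l [L [sL L0 minL]]] := minimal_stable s1 n1 (leqnn _).
exists l, L; split=> // m W sW W0.
have [/eqP c0|c0] := boolP ((W :&: L)%MS == 0).
  have [/eqP|/eqP] := stable_disjoint hT hu tu sW sL c0.
    by rewrite (negbTE W0).
  by rewrite (negbTE L0).
have := minL _ _ (stable_cap sW sL) c0 (capmxSr _ _).
by move=> h; apply: submx_trans h (capmxSl _ _).
Qed.

Lemma wt_vec T m (x : 'M[k]_(dim T, m)) w l : wt T w *m x = x ->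
  wt T l *m x = if l == w then x else 0.
Proof.
move=> hw; have -> : wt T l *m x = wt T l *m wt T w *m x by rewrite -mulmxA hw.
by rewrite wt_mul; case: eqP => _; rewrite ?hw ?mul0mx.
Qed.

(** The span of the vectors E_j x, a submodule when [x] is a weight vector killed
    by the F_j. *)
Definition span_E T (x : 'cV[k]_(dim T)) : 'M[k]_(q, dim T) :=
  \matrix_(j < q) (X T true j *m x)^T.

Lemma span_E_mem T (x : 'cV[k]_(dim T)) j : ((X T true j *m x)^T <= span_E x)%MS.
Proof.
case: (ltnP j q) => hj; last by rewrite (X_ge hp r_gt0) // mul0mx trmx0 sub0mx.
by have := row_sub (Ordinal hj) (span_E x); rewrite rowK.
Qed.

Lemma span_E_stable T (x : 'cV[k]_(dim T)) w :
  (forall i, (0 < i)%N -> X T false i *m x = 0) -> wt T w *m x = x -> stable (span_E x).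
Proof.
move=> hx hw; split=> [b i|n]; apply/row_subP => j;
  rewrite row_mul rowK -trmx_mul.
  case: b.
    by rewrite mulmxA (X_mul hp r_gt0) -scalemxAl linearZ scalemx_sub // span_E_mem.
  have [c ->] := X_swap_span (hp := hp) r_gt0 i j hx hw.
  rewrite linear_sum summx_sub // => l _.
  by rewrite linearZ scalemx_sub // span_E_mem.
rewrite mulmxA wt_X // -mulmxA (wt_vec _ hw).
case: eqP => _; last by rewrite mulmx0 trmx0 sub0mx.
exact: span_E_mem.
Qed.

Lemma span_E_neq0 T (x : 'cV[k]_(dim T)) : x != 0 -> span_E x != 0.
Proof.
apply: contraNneq => h; have := span_E_mem x 0; rewrite h => /submx0null e.
by apply/eqP/trmx_inj; rewrite trmx0 -e (X0 hp r_gt0) mul1mx.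
Qed.

Lemma shift_inj b i j : shift b i = shift b j -> i = j.
Proof.
rewrite /shift; case: b => [|/oppr_inj] => -[] /eqP.
  by rewrite eqn_mul2l => /eqP.
by rewrite eqn_mul2l => /eqP.
Qed.

(** The image of [topw T n] has weight [w]; the operator E_j of the right weight
    maps it injectively to the line of a weight vector [v] of the socle. *)
Lemma topw_rank_le1 T (u : 'M[k]_(dim T)) n :
  indecomposable T -> @wt_map k p r hp T T u -> @trace T T u = 1%:M ->
  (\rank (topw hp T n) <= 1)%N.
Proof.
move=> hT hu tu; have [l [L [sL L0 minL]]] := simple_socle hT hu tu.
set G := topw hp T n; pose w := n + shift false q.-1.
have [m0 hm0] : exists m0, L *m (wt T m0)^T != 0.
  apply: NNPP => hn; case/eqP: L0.
  rewrite -[L]mulmx1 -trmx1 -(wt_sum1 (hp := hp) (wsupp_uniq hp T) (fun _ h => h)).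
  rewrite linear_sum mulmx_sumr big1 // => m _; apply/eqP; apply: contraT => h.
  by case: hn; exists m.
have [i hi] : exists i, row i (L *m (wt T m0)^T) != 0.
  apply: NNPP => hn; case/eqP: hm0; apply/row_matrixP => i; rewrite row0.
  by apply/eqP; apply: contraT => h; case: hn; exists i.
pose v := (row i (L *m (wt T m0)^T))^T.
have v0 : v != 0 by apply: contraNneq hi => e; rewrite -[row _ _]trmxK -/v e trmx0.
have vL : (v^T <= L)%MS.
  rewrite trmxK; apply: submx_trans (row_sub _ _) _; exact: sL.2.
have vw : wt T m0 *m v = v.
  by rewrite /v row_mul trmx_mul trmxK mulmxA wt_mul eqxx.
have Glow (x : 'cV[k]_(dim T)) j : (0 < j)%N -> X T false j *m (G *m x) = 0.
  move=> j0; rewrite /G /topw !mulmxA (X_mul hp r_gt0) (X_ge hp r_gt0).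
    by rewrite scaler0 !mul0mx.
  by rewrite -{1}(prednK (q_gt0 r hp)) -add1n leq_add2r.
have Gw (x : 'cV[k]_(dim T)) : wt T w *m (G *m x) = G *m x.
  by rewrite /G /topw !mulmxA wt_X // addrK -[_ *m wt T n *m wt T n]mulmxA wt_mul eqxx.
have key (x : 'cV_(dim T)) : G *m x != 0 -> exists j c, [/\ m0 = w + shift true j,
    c != 0 & v = c *: (X T true j *m (G *m x))].
  move=> Gx; set z := G *m x in Gx *.
  have sz := span_E_stable (fun j => @Glow x j) (Gw x).
  have /submxP[D hD] := submx_trans vL (minL _ _ sz (span_E_neq0 Gx)).
  have vE : v = \sum_(j < q) D 0 j *: (X T true j *m z).
    rewrite -[v]trmxK hD mulmx_sum_row linear_sum; apply: eq_bigr => j _.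
    by rewrite linearZ rowK /= trmxK.
  have vE2 : v = \sum_(j < q) (if m0 - shift true j == w then D 0 j else 0) *: (X T true j *m z).
    rewrite -vw vE mulmx_sumr; apply: eq_bigr => j _.
    rewrite -scalemxAr mulmxA wt_X // -mulmxA (wt_vec _ (Gw x)).
    by case: eqP => _; rewrite // mulmx0 scaler0 scale0r.
  have [j hj] : exists j : 'I_q, m0 - shift true j == w.
    apply: NNPP => hn; case/eqP: v0; rewrite vE2 big1 // => j _.
    by case: ifP => [h|_]; [case: hn; exists j | rewrite scale0r].
  have hm : m0 = w + shift true j by rewrite -(eqP hj) subrK.
  have vE3 : v = D 0 j *: (X T true j *m z).
    rewrite vE2 (bigD1 j) //= hj big1 ?addr0 // => j' hj'.
    case: eqP => h; rewrite ?scale0r //; case/eqP: hj'; apply: val_inj.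
    apply: (@shift_inj true); apply: oppr_inj; apply: (addrI m0).
    by rewrite h (eqP hj).
  exists j, (D 0 j); split=> //.
  by apply: contraNneq v0 => h; rewrite vE3 h scale0r.
have [/eqP G0|G0] := boolP (G == 0); first by rewrite G0 mxrank0.
have [x0 hx0] : exists x0 : 'cV_(dim T), G *m x0 != 0.
  apply: NNPP => hn; case/eqP: G0; apply: cv_ext => x; rewrite mul0mx.
  by apply/eqP; apply: contraT => h; case: hn; exists x.
have [j0 [_ [hj0 _ _]]] := key _ hx0.
have key2 (x : 'cV_(dim T)) : G *m x != 0 ->
   exists2 c, c != 0 & v = c *: (X T true j0 *m (G *m x)).
  move=> /key[j [c [hj c0 vE]]]; exists c => //.
  suff <- : j = j0 by [].
  by apply: (@shift_inj true); apply: (addrI w); rewrite -hj.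
have rk : \rank G = \rank (X T true j0 *m G).
  rewrite -[in LHS]mxrank_tr -(mxrank_mul_ker G^T (X T true j0)^T) -trmx_mul mxrank_tr.
  suff -> : (G^T :&: kermx (X T true j0)^T)%MS = 0 by rewrite mxrank0 addn0.
  apply/eqP; rewrite -submx0; apply/row_subP => a; rewrite submx0.
  set y := row a _.
  have /andP[/submxP[z yz] /sub_kermxP yk] :
    (y <= G^T)%MS && (y <= kermx (X T true j0)^T)%MS by rewrite -sub_capmx row_sub.
  have yE : y = (G *m z^T)^T by rewrite trmx_mul trmxK.
  apply: contraT => y0.
  have Gz : G *m z^T != 0 by apply: contraNneq y0 => h; rewrite yE h trmx0.
  have [c c0 vE] := key2 _ Gz; case/eqP: v0; rewrite vE.
  suff -> : X T true j0 *m (G *m z^T) = 0 by rewrite scaler0.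
  by apply: trmx_inj; rewrite trmx_mul -yE yk trmx0.
rewrite rk -[leqLHS]mxrank_tr.
suff h : ((X T true j0 *m G)^T <= v^T)%MS.
  by rewrite (leq_trans (mxrankS h)) ?rank_leq_row.
apply/row_subP => a; rewrite -tr_col colE -mulmxA.
have [/eqP e|e] := boolP (G *m (delta_mx a 0 : 'cV_(dim T)) == 0).
  by rewrite e mulmx0 trmx0 sub0mx.
have [c c0 ->] := key2 _ e.
by rewrite linearZ eqmx_scale.
Qed.

Lemma Delta_mult_le1 T n s : indecomposable T ->
  filtration (@is_Delta k p r) T s -> (exists s', filtration (@is_nabla k p r) T s') ->
  (count_mem n s <= 1)%N.
Proof.
move=> hT hs [s' hs'].
have [tT cT] := Delta_filtration_top hp r_gt0 hs.
have h1 : @is_hom k _ T T 1%:M.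
  by move=> A g _; rewrite base_change1 mul1mx mulmx1.
have [u [hu tu]] := nabla_filtration_trace hp r_gt0 tT hs' h1.
exact: leq_trans (cT n) (topw_rank_le1 n hT hu (esym tu)).
Qed.
End Uniform.

Theorem proposition6p3 (k : closedFieldType) (p r : nat)
  (hp : p \in [pchar k]%R) (hp2 : (2 < p)%N) (hr : (0 < r)%N)
  (m n : int) (T : module (GrT (k := k) p r)) (hT : is_Tr m T)
  (c : nat) (hc : is_Delta_mult T n c) : c = 0%N \/ c = 1%N.
Proof.
have [hi [_ hn] _] := hT; have [s hs ->] := hc.
have := Delta_mult_le1 hp hr n hi hs hn.
by case: (count_mem n s) => [|[|]] // _; [left | right].
Qed.
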